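(* Let $k$ be a field of characteristic $0$. Given a fusion system $(L,N,F)$ defined over $k$, one can construct from it a fusion category $\mathcal{C}(L,N,F)$ over $k$, such that for every fusion category $\mathcal{C}$ over $k$ and every fusion system $(L,N,F)(\mathcal{C})$ extracted from it, $\mathcal{C}((L,N,F)(\mathcal{C}))\simeq\mathcal{C}$ as fusion categories.
   Context: A fusion category over $k$ is a $k$-linear abelian, semisimple, rigid monoidal category with finite-dimensional morphism spaces and finitely many isomorphism classes of simple objects, with simple neutral object $\mathbf 1$ and $\mathrm{End}(a)=k$ for every simple $a$. Associator: $\alpha_{x,y,z}:x\otimes(y\otimes z)\to(x\otimes y)\otimes z$; unit isomorphisms $\lambda_x:\mathbf 1\otimes x\to x$, $\rho_x:x\otimes\mathbf 1\to x$. Right dual of $x$: $x^*$ with $c_x:\mathbf 1\to x^*\otimes x$, $e_x:x\otimes x^*\to\mathbf 1$ satisfying the two zig-zag identities. Equivalences of fusion categories are $k$-linear monoidal. A **fusion system** $(L,N,F)$ over $k$ consists of: (1) a finite set $L$ with distinguished element $\mathbf 1$ and an involution $*$ on $L$ with $\mathbf 1^*=\mathbf 1$; (2) integers $N_{ab}^c\ge 0$ ($a,b,c\in L$) with $N_{\mathbf 1a}^b=\delta_{ab}=N_{a\mathbf 1}^b$, $N_{ab}^{\mathbf 1}=\delta_{a^*b}$, and $N_{abc}^u:=\sum_e N_{ab}^eN_{ec}^u=\sum_{e'}N_{ae'}^uN_{bc}^{e'}$; (3) for all $a,b,c,u\in L$ an invertible matrix $F_{abc}^u\in\mathrm{Mat}_{N_{abc}^u\times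 N_{abc}^u}(k)$ with entries $F_{abc}^u\left[\begin{smallmatrix} i&e&j \\ i'&e'&j'\end{smallmatrix}\right]$, where $e,e'\in L$, $1\le i\le N_{ab}^e$, $1\le j\le N_{ec}^u$, $1\le i'\le N_{ae'}^u$, $1\le j'\le N_{bc}^{e'}$, subject to: $F_{a\mathbf 1b}^u=I_{N_{ab}^u}$; $u_a:=F_{aa^*a}^a\left[\begin{smallmatrix}1&\mathbf 1&1 \\ 1&\mathbf 1&1\end{smallmatrix}\right]\ne0$; and the pentagon equations $$\sum_{l=1}^{N_{eg}^u}F_{ecd}^u\left[\begin{smallmatrix}j&f&k \\ l&g&m\end{smallmatrix}\right]F_{abg}^u\left[\begin{smallmatrix}i&e&l \\ n&h&o\end{smallmatrix}\right]=\sum_{q\in L}\sum_{p=1}^{N_{aq}^f}\sum_{r=1}^{N_{bc}^q}\sum_{v=1}^{N_{qd}^h}F_{abc}^f\left[\begin{smallmatrix}i&e&j \\ p&q&r\end{smallmatrix}\right]F_{aqd}^u\left[\begin{smallmatrix}p&f&k \\ n&h&v\end{smallmatrix}\right]F_{bcd}^h\left[\begin{smallmatrix}r&q&v \\ o&g&m\end{smallmatrix}\right]$$ for all $a,b,c,d,u,e,f,g,h\in L$, $i\le N_{ab}^e$, $j\le N_{ec}^f$, $k\le N_{fd}^u$, $n\le N_{ah}^u$, $o\le N_{bg}^h$, $m\le N_{cd}^g$ (all indices starting at $1$). **Extraction** $(L,N,F)(\mathcal C)$ from a fusion category $\mathcal C$: $L$ is a set of representatives of the isomorphism classes of simple objects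 containing $\mathbf 1$, with involution given by right duals; $N_{ab}^c=\dim_k\mathcal C(a\otimes b,c)$. Choose bases $\{\eta_{ab}^{c,i}\}_{i=1}^{N_{ab}^c}$ of $\mathcal C(a\otimes b,c)$ with $\eta_{\mathbf 1a}^{a,1}=\lambda_a$, $\eta_{a\mathbf 1}^{a,1}=\rho_a$, $\eta_{aa^*}^{\mathbf 1,1}=e_a$, and define $F$ by $$\eta_{ec}^{u,j}\circ(\eta_{ab}^{e,i}\otimes1_c)\circ\alpha_{a,b,c}=\sum_{e',i',j'}F_{abc}^u\left[\begin{smallmatrix}i&e&j \\ i'&e'&j'\end{smallmatrix}\right]\eta_{ae'}^{u,i'}\circ(1_a\otimes\eta_{bc}^{e',j'}).$$ The result depends on the chosen bases. **Construction** $\mathcal C(L,N,F)$: objects are functions $f:L\to\mathbb Z_{\ge0}$; morphisms $f\to f'$ are elements of $\bigoplus_{a\in L}\mathrm{Mat}_{f'(a)\times f(a)}(k)$, composed by matrix multiplication; simple objects are the delta functions, identified with $a\in L$; $(f\otimes g)(c)=\sum_{a,b}f(a)g(b)N_{ab}^c$ on objects and $\big(\sum_aA(a)\big)\otimes\big(\sum_bB(b)\big)=\sum_c\big(\sum_{a,b}A(a)\otimes B(b)\otimes I_{N_{ab}^c}\big)$ on morphisms; the unit is $\mathbf 1$ with identity unit isomorphisms; the associator is given on simples by $\alpha_{a,b,c}=\sum_{u}F_{abc}^u$ and extended additively; duals are $f^*(a)=f(a^* )$, with evaluation $e_a=1$ and coevaluation $c_a=1/u_a$ on simples (under the identification of the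 relevant one-dimensional morphism spaces with $k$). *)

(* Defs.v *)
From HB Require Import structures.
From mathcomp Require Import all_boot all_algebra.
Set Implicit Arguments.
Unset Strict Implicit.
Unset Printing Implicit Defensive.
Import GRing.Theory.
Local Open Scope ring_scope.

(* The operations of a monoidal category enriched over finite-dimensional
   [k]-vector spaces; all the laws are in [is_fusion_category]. *)
Record moncat_data (k : fieldType) := MoncatData {
  obj :> Type;
  hom : obj -> obj -> vectType k;
  idm : forall x, hom x x;
  comp : forall x y z, hom y z -> hom x y -> hom x z;
  tens : obj -> obj -> obj;
  tensm : forall x x' y y', hom x x' -> hom y y' -> hom (tens x y) (tens x' y');
  unit_obj : obj;
  assoc : forall x y z, hom (tens x (tens y z)) (tens (tens x y) z);
  lunit : forall x, hom (tens unit_obj x) x;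
  runit : forall x, hom (tens x unit_obj) x
}.
Arguments unit_obj {k m}.
Arguments idm {k m} x.

Declare Scope cat_scope.
Delimit Scope cat_scope with cat.
Notation "g \oc f" := (comp g f) (at level 50, left associativity) : cat_scope.
Notation "x \ot y" := (tens x y) (at level 45, left associativity) : cat_scope.
Notation "f \om g" := (tensm f g) (at level 45, left associativity) : cat_scope.
Local Open Scope cat_scope.

Section CategoryNotions.
Variables (k : fieldType) (C : moncat_data k).
Implicit Types x y z s : C.

Definition inverse_pair x y (f : hom x y) (g : hom y x) : Prop :=
  g \oc f = idm x /\ f \oc g = idm y.

Definition is_iso x y (f : hom x y) : Prop := exists g, inverse_pair f g.

Definition isomorphic x y : Prop := exists f : hom x y, is_iso f.

Definition is_mono x y (f : hom x y) : Prop :=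
  forall z (g h : hom z x), f \oc g = f \oc h -> g = h.

Definition is_epi x y (f : hom x y) : Prop :=
  forall z (g h : hom y z), g \oc f = h \oc f -> g = h.

Definition is_kernel x y (f : hom x y) z (i : hom z x) : Prop :=
  f \oc i = 0 /\
  forall w (g : hom w x), f \oc g = 0 -> exists! h : hom w z, i \oc h = g.

Definition is_cokernel x y (f : hom x y) z (p : hom y z) : Prop :=
  p \oc f = 0 /\
  forall w (g : hom y w), g \oc f = 0 -> exists! h : hom z w, h \oc p = g.

(* For [n = 0] this says that [x] is a zero object. *)
Definition is_direct_sum n (s : 'I_n -> C) x : Prop :=
  exists (i : forall j, hom (s j) x) (p : forall j, hom x (s j)),
    [/\ forall j, p j \oc i j = idm (s j),
        forall j l, j != l -> p j \oc i l = 0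
      & \sum_j (i j \oc p j) = idm x].

Definition is_category : Prop :=
  [/\ forall x y (f : hom x y), idm y \oc f = f,
      forall x y (f : hom x y), f \oc idm x = f
    & forall x y z w (f : hom x y) (g : hom y z) (h : hom z w),
        h \oc (g \oc f) = h \oc g \oc f].

Definition is_linear_category : Prop :=
  (forall x y z (g : hom y z) (c : k) (f f' : hom x y),
     g \oc (c *: f + f') = c *: (g \oc f) + (g \oc f')) /\
  (forall x y z (f : hom x y) (c : k) (g g' : hom y z),
     (c *: g + g') \oc f = c *: (g \oc f) + (g' \oc f)).

Definition is_abelian : Prop :=
  [/\ forall n (s : 'I_n -> C), exists x, is_direct_sum s x,
      forall x y (f : hom x y), exists z (i : hom z x), is_kernel f i,
      forall x y (f : hom x y), exists z (p : hom y z), is_cokernel f p,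
      forall x y (i : hom x y), is_mono i ->
        exists z (f : hom y z), is_kernel f i
    & forall x y (p : hom x y), is_epi p ->
        exists z (f : hom z x), is_cokernel f p].

(* An object is zero iff its identity morphism is zero. *)
Definition is_simple x : Prop :=
  idm x <> 0 /\
  forall y (i : hom y x), is_mono i -> i = 0 \/ is_iso i.

Definition is_semisimple : Prop :=
  forall x, exists n (s : 'I_n -> C),
    (forall j, is_simple (s j)) /\ is_direct_sum s x.

Definition finitely_many_simples : Prop :=
  exists n (s : 'I_n -> C), forall x, is_simple x -> exists j, isomorphic x (s j).

Definition is_monoidal : Prop :=
  [/\ [/\ forall x y, idm x \om idm y = idm (x \ot y)
        & forall x x' x'' y y' y'' (f : hom x x') (f' : hom x' x'')
            (g : hom y y') (g' : hom y' y''),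
            (f' \oc f) \om (g' \oc g) = (f' \om g') \oc (f \om g)],
      [/\ forall x y z, is_iso (assoc x y z),
          forall x, is_iso (lunit x)
        & forall x, is_iso (runit x)],
      [/\ forall x x' y y' z z' (f : hom x x') (g : hom y y') (h : hom z z'),
            assoc x' y' z' \oc (f \om (g \om h))
            = ((f \om g) \om h) \oc assoc x y z,
          forall x y (f : hom x y),
            lunit y \oc (idm unit_obj \om f) = f \oc lunit x
        & forall x y (f : hom x y),
            runit y \oc (f \om idm unit_obj) = f \oc runit x],
      forall x y z w,
        assoc (x \ot y) z w \oc assoc x y (z \ot w)
        = (assoc x y z \om idm w) \oc assoc x (y \ot z) w
          \oc (idm x \om assoc y z w)
    & forall x y,
        (runit x \om idm y) \oc assoc x unit_obj y = idm x \om lunit y].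

Definition is_tensor_bilinear : Prop :=
  (forall x x' y y' (f : hom x x') (c : k) (g g' : hom y y'),
     f \om (c *: g + g') = c *: (f \om g) + (f \om g')) /\
  (forall x x' y y' (g : hom y y') (c : k) (f f' : hom x x'),
     (c *: f + f') \om g = c *: (f \om g) + (f' \om g)).

(* [x'] is a right dual of [x] with coevaluation [c] and evaluation [e]; the
   inverse unit isomorphisms of the zig-zag identities are moved to the
   right-hand sides. *)
Definition is_right_dual x x' (c : hom unit_obj (x' \ot x))
    (e : hom (x \ot x') unit_obj) : Prop :=
  lunit x \oc (e \om idm x) \oc assoc x x' x \oc (idm x \om c) = runit x /\
  exists2 ai, inverse_pair (assoc x' x x') ai
    & runit x' \oc (idm x' \om e) \oc ai \oc (c \om idm x') = lunit x'.

Definition is_rigid : Prop :=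
  (forall x, exists x' c e, @is_right_dual x x' c e) /\
  (forall x, exists x' c e, @is_right_dual x' x c e).

Definition is_fusion_category : Prop :=
  [/\ is_category /\ is_linear_category,
      is_abelian /\ is_semisimple,
      [/\ is_monoidal, is_tensor_bilinear & is_rigid],
      finitely_many_simples /\ is_simple unit_obj
    & forall x, is_simple x -> bijective (fun c : k => c *: idm x)].

End CategoryNotions.

Record fusion_category (k : fieldType) := FusionCategory {
  fusion_data :> moncat_data k;
  fusion_ax : is_fusion_category fusion_data
}.

Section Equivalence.
Variable k : fieldType.

Record linear_functor (C D : moncat_data k) := LinearFunctor {
  fobj :> C -> D;
  fmap : forall x y : C, {linear hom x y -> hom (fobj x) (fobj y)};
  fmap_id : forall x, fmap x x (idm x) = idm (fobj x);
  fmap_comp : forall x y z (g : hom y z) (f : hom x y),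
    fmap x z (g \oc f) = fmap y z g \oc fmap x y f
}.
Arguments fmap {C D} l {x y}.

(* [J] and [J0] make [F] a (strong) monoidal functor. *)
Definition is_monoidal_functor (C D : moncat_data k) (F : linear_functor C D)
    (J : forall x y : C, hom (F x \ot F y) (F (x \ot y)))
    (J0 : hom unit_obj (F unit_obj)) : Prop :=
  [/\ (forall x y, is_iso (J x y)) /\ is_iso J0,
      forall x x' y y' (f : hom x x') (g : hom y y'),
        fmap F (f \om g) \oc J x y = J x' y' \oc (fmap F f \om fmap F g),
      forall x y z,
        fmap F (assoc x y z) \oc J x (y \ot z) \oc (idm (F x) \om J y z)
        = J (x \ot y) z \oc (J x y \om idm (F z)) \oc assoc (F x) (F y) (F z),
      forall x,
        fmap F (lunit x) \oc J unit_obj x \oc (J0 \om idm (F x)) = lunit (F x)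
    & forall x,
        fmap F (runit x) \oc J x unit_obj \oc (idm (F x) \om J0) = runit (F x)].

Definition is_equivalence (C D : moncat_data k) (F : linear_functor C D) : Prop :=
  exists (G : linear_functor D C)
    (eta : forall x : C, hom x (G (F x))) (eps : forall y : D, hom (F (G y)) y),
    [/\ forall x, is_iso (eta x),
        forall x x' (f : hom x x'), fmap G (fmap F f) \oc eta x = eta x' \oc f,
        forall y, is_iso (eps y)
      & forall y y' (g : hom y y'), eps y' \oc fmap F (fmap G g) = g \oc eps y].

Definition fusion_equivalent (C D : moncat_data k) : Prop :=
  exists F : linear_functor C D,
    (exists J J0, @is_monoidal_functor C D F J J0) /\ is_equivalence F.

End Equivalence.

Record fusion_rules := FusionRules {
  label :> finType;
  one : label;
  dual : label -> label;
  mult : label -> label -> label -> nat;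
  dualK : involutive dual;
  dual_one : dual one = one;
  mult1l : forall a b, mult one a b = (a == b);
  mult1r : forall a b, mult a one b = (a == b);
  mult_one : forall a b, mult a b one = (dual a == b);
  multA : forall a b c u,
    (\sum_e mult a b e * mult e c u = \sum_e mult a e u * mult b c e)%N
}.
Arguments one {_}.
Arguments dual {_}.
Arguments mult {_}.

Section FusionRules.
Variable R : fusion_rules.
Implicit Types a b c e u : R.

Lemma mult1l_diag a : mult one a a = 1%N.
Proof. by rewrite mult1l eqxx. Qed.

Lemma mult1r_diag a : mult a one a = 1%N.
Proof. by rewrite mult1r eqxx. Qed.

Lemma mult_dualr a : mult a (dual a) one = 1%N.
Proof. by rewrite mult_one eqxx. Qed.

Lemma mult_duall a : mult (dual a) a one = 1%N.
Proof. by rewrite mult_one dualK eqxx. Qed.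

Definition index1 n (n1 : n = 1%N) : 'I_n := cast_ord (esym n1) ord0.
Definition idx1l a : 'I_(mult one a a) := index1 (mult1l_diag a).
Definition idx1r a : 'I_(mult a one a) := index1 (mult1r_diag a).
Definition idx_dualr a : 'I_(mult a (dual a) one) := index1 (mult_dualr a).
Definition idx_duall a : 'I_(mult (dual a) a one) := index1 (mult_duall a).

(* Row indices (i, e, j) and column indices (i', e', j') of the matrix
   F_{abc}^u; both index sets have N_{abc}^u elements. *)
Definition row_index a b c u : finType :=
  {e : R & ('I_(mult a b e) * 'I_(mult e c u))%type}.
Definition col_index a b c u : finType :=
  {e : R & ('I_(mult a e u) * 'I_(mult b c e))%type}.

Definition row_ix a b c u (e : R) (i : 'I_(mult a b e)) (j : 'I_(mult e c u)) :
  row_index a b c u := existT _ e (i, j).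
Definition col_ix a b c u (e : R) (i : 'I_(mult a e u)) (j : 'I_(mult b c e)) :
  col_index a b c u := existT _ e (i, j).

End FusionRules.

Record fusion_system (k : fieldType) := FusionSystem {
  rules :> fusion_rules;
  Fmat : forall a b c u : rules, row_index a b c u -> col_index a b c u -> k;
  Fmat_inv : forall a b c u : rules,
    exists G : col_index a b c u -> row_index a b c u -> k,
      (forall p p', \sum_q Fmat p q * G q p' = (p == p')%:R) /\
      (forall q q', \sum_p G q p * Fmat p q' = (q == q')%:R);
  Fmat_one : forall (a b u : rules) (j i : 'I_(mult a b u)),
    Fmat (row_ix (idx1r a) j) (col_ix i (idx1l b)) = (j == i)%:R;
  Fmat_dual : forall a : rules,
    Fmat (row_ix (idx_dualr a) (idx1l a)) (col_ix (idx1r a) (idx_duall a)) != 0;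
  Fmat_pentagon : forall (a b c d u e f g h : rules)
      (i : 'I_(mult a b e)) (j : 'I_(mult e c f)) (k : 'I_(mult f d u))
      (n : 'I_(mult a h u)) (o : 'I_(mult b g h)) (m : 'I_(mult c d g)),
    \sum_(l < mult e g u)
      Fmat (row_ix j k) (col_ix l m) * Fmat (row_ix i l) (col_ix n o)
    = \sum_(q : rules) \sum_(p < mult a q f) \sum_(r < mult b c q)
      \sum_(v < mult q d h)
        Fmat (row_ix i j) (col_ix p r) * Fmat (row_ix p k) (col_ix n v)
        * Fmat (row_ix r v) (col_ix o m)
}.
Arguments Fmat {k _ a b c u}.

(* u_a = F_{aa*a}^a [1 one 1; 1 one 1] *)
Definition dual_scalar (k : fieldType) (S : fusion_system k) (a : S) : k :=
  Fmat (row_ix (idx_dualr a) (idx1l a)) (col_ix (idx1r a) (idx_duall a)).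

Section MatrixFamilies.
Variables (k : fieldType) (L : finType).
Implicit Types f g : L -> nat.

Definition mxfam f g := {dffun forall a : L, 'M[k]_(g a, f a)}.

Section VectorSpace.
Variables f g : L -> nat.
Implicit Types A B : mxfam f g.

HB.instance Definition _ := Choice.on (mxfam f g).

Definition mxfam_zero : mxfam f g := [ffun a => (0 : 'M[k]_(g a, f a))].
Definition mxfam_opp A : mxfam f g := [ffun a => - A a].
Definition mxfam_add A B : mxfam f g := [ffun a => A a + B a].
Definition mxfam_scale (c : k) A : mxfam f g := [ffun a => c *: A a].

Fact mxfam_addA : associative mxfam_add.
Proof. by move=> A B D; apply/ffunP=> a; rewrite !ffunE addrA. Qed.
Fact mxfam_addC : commutative mxfam_add.
Proof. by move=> A B; apply/ffunP=> a; rewrite !ffunE addrC. Qed.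
Fact mxfam_add0 : left_id mxfam_zero mxfam_add.
Proof. by move=> A; apply/ffunP=> a; rewrite !ffunE add0r. Qed.
Fact mxfam_addN : left_inverse mxfam_zero mxfam_opp mxfam_add.
Proof. by move=> A; apply/ffunP=> a; rewrite !ffunE addNr. Qed.

HB.instance Definition _ := GRing.isZmodule.Build (mxfam f g)
  mxfam_addA mxfam_addC mxfam_add0 mxfam_addN.

Fact mxfam_scaleA c d A :
  mxfam_scale c (mxfam_scale d A) = mxfam_scale (c * d) A.
Proof. by apply/ffunP=> a; rewrite !ffunE scalerA. Qed.
Fact mxfam_scale1 : left_id 1 mxfam_scale.
Proof. by move=> A; apply/ffunP=> a; rewrite !ffunE scale1r. Qed.
Fact mxfam_scaleDr : right_distributive mxfam_scale +%R.
Proof. by move=> c A B; apply/ffunP=> a; rewrite !ffunE scalerDr. Qed.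
Fact mxfam_scaleDl A : {morph mxfam_scale^~ A : c d / c + d}.
Proof. by move=> c d; apply/ffunP=> a; rewrite !ffunE scalerDl. Qed.

HB.instance Definition _ := GRing.Zmodule_isLmodule.Build k (mxfam f g)
  mxfam_scaleA mxfam_scale1 mxfam_scaleDr mxfam_scaleDl.

Let entry : finType := {a : L & ('I_(g a) * 'I_(f a))%type}.

Fact mxfam_vect_iso : Vector.axiom #|entry| (mxfam f g).
Proof.
exists (fun A => \row_p A (tag (enum_val p))
                    (tagged (enum_val p)).1 (tagged (enum_val p)).2).
  by move=> c A B; apply/rowP=> p; rewrite !mxE !ffunE !mxE.
exists (fun v : 'rV_#|entry| => [ffun a => \matrix_(i < g a, j < f a)
          v 0 (enum_rank (Tagged (fun a => 'I_(g a) * 'I_(f a))%type (i, j)))]).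
- by move=> A; apply/ffunP=> a; apply/matrixP=> i j; rewrite ffunE !mxE enum_rankK.
- move=> v; apply/rowP=> p; rewrite mxE ffunE mxE -[in RHS](enum_valK p).
  by case: (enum_val p) => a [i j].
Qed.

HB.instance Definition _ :=
  Lmodule_hasFinDim.Build k (mxfam f g) mxfam_vect_iso.

End VectorSpace.

Definition mxfam_id f : mxfam f f := [ffun a => 1%:M].
Definition mxfam_comp f g h (B : mxfam g h) (A : mxfam f g) : mxfam f h :=
  [ffun a => B a *m A a].

End MatrixFamilies.

Section Construction.
Variables (k : fieldType) (S : fusion_system k).
Implicit Types (a b c u : S) (f g h : S -> nat).

Definition tens_obj f g : S -> nat :=
  fun c => (\sum_a \sum_b f a * g b * mult a b c)%N.

(* The Kronecker products in the degree [c] part of [f \ot g] have indices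
   (x, y, l) in the block (a, b). *)
Definition tens_index f g c : finType :=
  {p : S * S & ('I_(f p.1) * 'I_(g p.2) * 'I_(mult p.1 p.2 c))%type}.

Lemma card_tens_index f g c : #|tens_index f g c| = tens_obj f g c.
Proof.
rewrite card_tagged sumnE big_map big_enum /tens_obj pair_bigA /=.
by apply: eq_bigr => -[a b] _; rewrite !card_prod !card_ord.
Qed.

Definition tens_ix f g c a b (x : 'I_(f a)) (y : 'I_(g b)) (l : 'I_(mult a b c)) :
    'I_(tens_obj f g c) :=
  cast_ord (card_tens_index f g c)
    (enum_rank (existT _ (a, b) (x, y, l) : tens_index f g c)).

(* The sum over (a, b) of the Kronecker products A(a), B(b) and the identity
   matrix, expanded on matrix units. *)
Definition tens_mor f f' g g' (A : mxfam k f f') (B : mxfam k g g') :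
    mxfam k (tens_obj f g) (tens_obj f' g') :=
  [ffun c => \sum_a \sum_b
     \sum_(x' < f' a) \sum_(x < f a) \sum_(y' < g' b) \sum_(y < g b)
     \sum_(l < mult a b c)
       (A a x' x * B b y' y) *: delta_mx (tens_ix x' y' l) (tens_ix x y l)].

Definition simple_obj a : S -> nat := fun b => (a == b).

Fact simple_obj_diag a : simple_obj a a = 1%N.
Proof. by rewrite /simple_obj eqxx. Qed.

Definition simple_ix a : 'I_(simple_obj a a) := index1 (simple_obj_diag a).

(* (x, y, z) runs over the summands of [f \ot (g \ot h)] isomorphic to
   [a \ot (b \ot c)]; on each of them the associator is F_{abc}^u. *)
Definition assoc_mor f g h :
    mxfam k (tens_obj f (tens_obj g h)) (tens_obj (tens_obj f g) h) :=
  [ffun u => \sum_a \sum_b \sum_c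
     \sum_(x < f a) \sum_(y < g b) \sum_(z < h c)
     \sum_(p : row_index a b c u) \sum_(q : col_index a b c u)
       Fmat p q *:
         delta_mx (tens_ix (tens_ix x y (tagged p).1) z (tagged p).2)
                  (tens_ix x (tens_ix y z (tagged q).2) (tagged q).1)].

(* [tens_obj (simple_obj one) f] and [f] are equal objects; the identity
   matrix is written along the bijection of indices. *)
Definition lunit_mor f : mxfam k (tens_obj (simple_obj one) f) f :=
  [ffun c => \sum_(y < f c)
     delta_mx y (tens_ix (simple_ix one) y (idx1l c))].

Definition runit_mor f : mxfam k (tens_obj f (simple_obj one)) f :=
  [ffun c => \sum_(x < f c)
     delta_mx x (tens_ix x (simple_ix one) (idx1r c))].

Definition system_category : moncat_data k :=
  @MoncatData k (S -> nat) (fun f g => mxfam k f g : vectType k)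
    (@mxfam_id k S) (@mxfam_comp k S) tens_obj tens_mor
    (simple_obj one) assoc_mor lunit_mor runit_mor.

Definition dual_obj f : S -> nat := fun a => f (dual a).

(* The label [b] of [dual_obj f] pairs with the label [a] of [f] when
   [b = dual a]; then [f (dual b) = f a] and equal copies are paired. *)
Definition ev_mor f : mxfam k (tens_obj f (dual_obj f)) (simple_obj one) :=
  [ffun c => \sum_(r < simple_obj one c) \sum_a \sum_(b | b == dual a)
     \sum_(x < f a) \sum_(y < dual_obj f b | x == y :> nat)
     \sum_(l < mult a b c) delta_mx r (tens_ix x y l)].

Definition coev_mor f : mxfam k (simple_obj one) (tens_obj (dual_obj f) f) :=
  [ffun c => \sum_(r < simple_obj one c) \sum_a \sum_(b | b == dual a)
     \sum_(x < f a) \sum_(y < dual_obj f b | x == y :> nat)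
     \sum_(l < mult b a c)
       (dual_scalar a)^-1 *: delta_mx (tens_ix y x l) r].

End Construction.

Section ExtractedSystems.
Variables (k : fieldType) (C : moncat_data k).

Definition hom_of_eq (x y : C) (xy : x = y) : hom x y :=
  match xy in _ = z return hom x z with erefl => idm x end.

(* [rep] identifies the labels with chosen simple objects. As
   [rep one = unit_obj] is only a propositional equality, the normalizations
   of [eta] go through [hom_of_eq]. *)
Definition extracted (S : fusion_system k) : Prop :=
  exists (rep : S -> C) (rep1 : rep one = unit_obj)
    (coev : forall a, hom unit_obj (rep (dual a) \ot rep a))
    (ev : forall a, hom (rep a \ot rep (dual a)) unit_obj)
    (eta : forall a b c, 'I_(mult a b c) -> hom (rep a \ot rep b) (rep c)),
    [/\ [/\ forall a, is_simple (rep a),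
            forall a b, isomorphic (rep a) (rep b) -> a = b
          & forall x : C, is_simple x -> exists a, isomorphic x (rep a)],
        forall a, is_right_dual (coev a) (ev a),
        forall a b c,
          mult a b c = \dim {: hom (rep a \ot rep b) (rep c)} /\
          basis_of fullv [seq eta a b c i | i : 'I_(mult a b c)],
        [/\ forall a, eta one a a (idx1l a)
              = lunit (rep a) \oc (hom_of_eq rep1 \om idm (rep a)),
            forall a, eta a one a (idx1r a)
              = runit (rep a) \oc (idm (rep a) \om hom_of_eq rep1)
          & forall a, eta a (dual a) one (idx_dualr a)
              = hom_of_eq (esym rep1) \oc ev a]
      & forall a b c u (p : row_index a b c u),
          eta (tag p) c u (tagged p).2
            \oc (eta a b (tag p) (tagged p).1 \om idm (rep c))
            \oc assoc (rep a) (rep b) (rep c)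
          = \sum_(q : col_index a b c u)
              Fmat p q *: (eta a (tag q) u (tagged q).1
                \oc (idm (rep a) \om eta b c (tag q) (tagged q).2))].

End ExtractedSystems.

(* Main.v *)
(* A row vector [u : 'rV_(f a)] is a morphism from [f] to the simple object [a],
   and morphisms of the matrix category are determined by their composites with
   all row vectors. The rows of [f \ot g] in degree [c] are spanned by the
   composites of [u \ot v] with a basis morphism of [a \ot b -> c]; on them the
   associator acts by F, so the monoidal axioms become the axioms of a fusion
   system. The evaluation and coevaluation satisfy the first zig-zag identity by
   a direct computation; the second one follows from it because the evaluation is
   nondegenerate, so no formula for the inverse of F is needed.

   For an extracted system, f is sent to a direct sum of f(a) copies of each
   representative a. Composition with row vectors identifies the morphisms from
   this sum to a with 'rV_(f a), which makes the functor fully faithful; the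
   chosen bases of Hom(a \ot b, c) give the monoidal structure, and a morphism is
   invertible as soon as it induces bijections on the spaces Hom(-, a). *)
Require Import Defs.
From HB Require Import structures.
From mathcomp Require Import all_boot all_algebra.
From Stdlib Require Import FunctionalExtensionality ClassicalEpsilon.
Set Implicit Arguments.
Unset Strict Implicit.
Unset Printing Implicit Defensive.
(* [Defs] is imported again because MathComp's [one] hides the label [one]. *)
Import GRing.Theory Defs.
Local Open Scope ring_scope.
Local Open Scope cat_scope.

(** * Row vectors of tensor products *)

(** The obstacle is bookkeeping. The entries of [tens_obj f g] are sums of products of
    multiplicities, their indices are numbered by an enumeration, and the two bracketings of a
    triple product are not convertible and carry unrelated numberings. Rows avoid the numbering: the
    formula of a structure morphism is expanded only to find its action on [tens_row], and each
    axiom then becomes an identity between linear combinations of such rows.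

    Composition with rows is contravariant: a left-bracketed row times [assoc_mor] is a combination
    of right-bracketed rows with coefficients [F]. This is the relation that defines [F] in an
    extracted system, so the same matrix, neither transposed nor inverted, serves in both
    directions.

    Inverses of [F], direct sums of representatives and preimages under the functor are only known
    to exist, and are picked by [constructive_indefinite_description]. Functional extensionality
    serves to identify the double dual of an object with the object. *)

Section MatrixFamilyEntries.
Variables (k : fieldType) (L : finType).
Implicit Types f g h : L -> nat.

Lemma mxfam_idE f a : mxfam_id k f a = 1%:M.
Proof. by rewrite ffunE. Qed.

Lemma mxfam_compE f g h (B : mxfam k g h) (A : mxfam k f g) a :
  mxfam_comp B A a = B a *m A a.
Proof. by rewrite ffunE. Qed.

Lemma mxfam_linE f g z (A B : mxfam k f g) a :
  (z *: A + B) a = z *: A a + B a.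
Proof. by rewrite [LHS]ffunE [X in X + _]ffunE. Qed.

Lemma mxfam0E f g a : (0 : mxfam k f g) a = 0.
Proof. by rewrite [LHS]ffunE. Qed.

Lemma mxfam_sumE f g (I : Type) (r : seq I) (A : I -> mxfam k f g) a :
  (\sum_(i <- r) A i) a = \sum_(i <- r) A i a.
Proof.
elim/big_rec2: _ => [|i B C _ <-]; first exact: mxfam0E.
by rewrite -[A i in LHS]scale1r mxfam_linE scale1r.
Qed.

End MatrixFamilyEntries.

Section TensorRows.
Variables (k : fieldType) (S : fusion_system k).
Implicit Types (a b c d e : S) (f g h : S -> nat).

Definition tens_dec f g c (i : 'I_(tens_obj f g c)) : tens_index f g c :=
  enum_val (cast_ord (esym (card_tens_index f g c)) i).

Lemma tens_ixK f g c a b (x : 'I_(f a)) (y : 'I_(g b)) (l : 'I_(mult a b c)) :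
  tens_dec (tens_ix x y l) = existT _ (a, b) (x, y, l).
Proof. by rewrite /tens_dec /tens_ix cast_ordK enum_rankK. Qed.

(** A view: [case: (tens_ixP i)] turns an arbitrary index of a tensor product into a block index, so
    that the enumeration behind [tens_obj] never has to be computed. *)
Variant tens_ix_spec f g c : 'I_(tens_obj f g c) -> Prop :=
  TensIx a b (x : 'I_(f a)) (y : 'I_(g b)) (l : 'I_(mult a b c)) :
    tens_ix_spec (tens_ix x y l).

Lemma tens_ixP f g c (i : 'I_(tens_obj f g c)) : tens_ix_spec i.
Proof.
have -> : i = cast_ord (card_tens_index f g c) (enum_rank (tens_dec i)).
  by rewrite /tens_dec enum_valK cast_ordKV.
by case: (tens_dec i) => -[a b] [[x y] l]; exact: TensIx.
Qed.

(* The composite of [u \ot v] with the basis morphism of index [l]. *)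
Definition tens_row f g a b c (u : 'rV[k]_(f a)) (v : 'rV[k]_(g b))
    (l : 'I_(mult a b c)) : 'rV[k]_(tens_obj f g c) :=
  \sum_x \sum_y (u 0 x * v 0 y) *: delta_mx 0 (tens_ix x y l).

Section Bilinear.
Variables (f g : S -> nat) (a b c : S) (l : 'I_(mult a b c)).
Implicit Types (u : 'rV[k]_(f a)) (v : 'rV[k]_(g b)).

Lemma tens_rowPl v z u u' :
  tens_row (z *: u + u') v l = z *: tens_row u v l + tens_row u' v l.
Proof.
rewrite scaler_sumr -big_split; apply: eq_bigr => x _ /=.
rewrite scaler_sumr -big_split; apply: eq_bigr => y _ /=.
by rewrite !mxE mulrDl scalerDl scalerA mulrA.
Qed.

Lemma tens_rowPr u z v v' :
  tens_row u (z *: v + v') l = z *: tens_row u v l + tens_row u v' l.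
Proof.
rewrite scaler_sumr -big_split; apply: eq_bigr => x _ /=.
rewrite scaler_sumr -big_split; apply: eq_bigr => y _ /=.
by rewrite !mxE mulrDr scalerDl scalerA mulrCA.
Qed.

Lemma tens_row0l v : tens_row (0 : 'rV_(f a)) v l = 0.
Proof. by have := tens_rowPl v (-1) 0 0; rewrite scaler0 addr0 scaleN1r addNr. Qed.

Lemma tens_row0r u : tens_row u (0 : 'rV_(g b)) l = 0.
Proof. by have := tens_rowPr u (-1) 0 0; rewrite scaler0 addr0 scaleN1r addNr. Qed.

Lemma tens_row_suml (I : finType) (w : I -> k) (U : I -> 'rV[k]_(f a)) v :
  tens_row (\sum_i w i *: U i) v l = \sum_i w i *: tens_row (U i) v l.
Proof.
rewrite (big_morph (fun u => tens_row u v l) (id1 := 0) (op1 := +%R)).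
- apply: eq_bigr => i _.
  by rewrite -[w i *: U i]addr0 tens_rowPl tens_row0l addr0.
- by move=> u u'; rewrite -[u in LHS]scale1r tens_rowPl scale1r.
- exact: tens_row0l.
Qed.

Lemma tens_row_bigl (I : finType) (P : pred I) (U : I -> 'rV[k]_(f a)) v :
  tens_row (\sum_(i | P i) U i) v l = \sum_(i | P i) tens_row (U i) v l.
Proof.
apply: (big_morph (fun u => tens_row u v l)); last exact: tens_row0l.
by move=> u u'; rewrite -[u in LHS]scale1r tens_rowPl scale1r.
Qed.

Lemma tens_row_sumr (I : finType) (w : I -> k) (V : I -> 'rV[k]_(g b)) u :
  tens_row u (\sum_i w i *: V i) l = \sum_i w i *: tens_row u (V i) l.
Proof.
rewrite (big_morph (fun v => tens_row u v l) (id1 := 0) (op1 := +%R)).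
- apply: eq_bigr => i _.
  by rewrite -[w i *: V i]addr0 tens_rowPr tens_row0r addr0.
- by move=> v v'; rewrite -[v in LHS]scale1r tens_rowPr scale1r.
- exact: tens_row0r.
Qed.

Lemma tens_row_delta (x : 'I_(f a)) (y : 'I_(g b)) :
  tens_row (delta_mx 0 x : 'rV_(f a)) (delta_mx 0 y : 'rV_(g b)) l
  = delta_mx 0 (tens_ix x y l).
Proof.
rewrite /tens_row (bigD1 x) //= (bigD1 y) //= !mxE !eqxx mulr1 scale1r.
rewrite !big1 ?addr0 // => [x' /negPf ne|y' /negPf ne].
  by rewrite big1 // => y' _; rewrite !mxE ne mul0r scale0r.
by rewrite !mxE ne mulr0 scale0r.
Qed.

End Bilinear.

Lemma mulmx_suml_scale (I : finType) (w : I -> k) m n (U : I -> 'rV[k]_m)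
    (M : 'M_(m, n)) :
  (\sum_i w i *: U i) *m M = \sum_i w i *: (U i *m M).
Proof. by rewrite mulmx_suml; apply: eq_bigr => i _; rewrite scalemxAl. Qed.

(** Unit vectors [u] and [v] already give every unit row. Arbitrary rows are allowed because the
    action formulas below preserve the shape [tens_row u v l] but not unit rows. *)
Lemma tens_row_ext f g c n (M N : 'M[k]_(tens_obj f g c, n)) :
  (forall a b (u : 'rV_(f a)) (v : 'rV_(g b)) (l : 'I_(mult a b c)),
     tens_row u v l *m M = tens_row u v l *m N) -> M = N.
Proof.
move=> eqMN; apply/row_matrixP => i; case: (tens_ixP i) => a b x y l.
by rewrite !rowE -tens_row_delta eqMN.
Qed.

Lemma tens_row_extl f g h d n (M N : 'M[k]_(tens_obj (tens_obj f g) h d, n)) :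
  (forall a b c e (u : 'rV_(f a)) (v : 'rV_(g b)) (w : 'rV_(h c))
     (i : 'I_(mult a b e)) (j : 'I_(mult e c d)),
     tens_row (tens_row u v i) w j *m M = tens_row (tens_row u v i) w j *m N) ->
  M = N.
Proof.
move=> eqMN; apply/row_matrixP => i; case: (tens_ixP i) => e c t z j.
case: (tens_ixP t) => a b x y i'.
by rewrite !rowE -!tens_row_delta eqMN.
Qed.

Lemma tens_row_extr f g h d n (M N : 'M[k]_(tens_obj f (tens_obj g h) d, n)) :
  (forall a b c e (u : 'rV_(f a)) (v : 'rV_(g b)) (w : 'rV_(h c))
     (i : 'I_(mult a e d)) (j : 'I_(mult b c e)),
     tens_row u (tens_row v w j) i *m M = tens_row u (tens_row v w j) i *m N) ->
  M = N.
Proof.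
move=> eqMN; apply/row_matrixP => i; case: (tens_ixP i) => a e x t i'.
case: (tens_ixP t) => b c y z j.
by rewrite !rowE -!tens_row_delta eqMN.
Qed.

Lemma tens_row_extll f g h f' d n
    (M N : 'M[k]_(tens_obj (tens_obj (tens_obj f g) h) f' d, n)) :
  (forall a b c a' e e' (u : 'rV_(f a)) (v : 'rV_(g b)) (w : 'rV_(h c))
     (t : 'rV_(f' a'))
     (i : 'I_(mult a b e)) (j : 'I_(mult e c e')) (r : 'I_(mult e' a' d)),
     tens_row (tens_row (tens_row u v i) w j) t r *m M
     = tens_row (tens_row (tens_row u v i) w j) t r *m N) ->
  M = N.
Proof.
move=> eqMN; apply/row_matrixP => i; case: (tens_ixP i) => e' a' t z j.
case: (tens_ixP t) => e c t' z' i'; case: (tens_ixP t') => a b x y i''.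
by rewrite !rowE -!tens_row_delta eqMN.
Qed.

Lemma tens_row_mulmx f g a b c n (M : 'M_(tens_obj f g c, n))
    (l : 'I_(mult a b c)) (Q : 'rV[k]_(f a) -> 'rV[k]_(g b) -> 'rV[k]_n) :
  (forall v z u u', Q (z *: u + u') v = z *: Q u v + Q u' v) ->
  (forall u z v v', Q u (z *: v + v') = z *: Q u v + Q u v') ->
  (forall x y, delta_mx 0 (tens_ix x y l) *m M = Q (delta_mx 0 x) (delta_mx 0 y)) ->
  forall u v, tens_row u v l *m M = Q u v.
Proof.
move=> Ql Qr QE u v.
have Q0l w : Q 0 w = 0.
  by have := Ql w (-1) 0 0; rewrite scaler0 addr0 scaleN1r addNr.
have Q0r w : Q w 0 = 0.
  by have := Qr w (-1) 0 0; rewrite scaler0 addr0 scaleN1r addNr.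
have QZl z u1 v1 : Q (z *: u1) v1 = z *: Q u1 v1.
  by rewrite -[z *: u1]addr0 Ql Q0l addr0.
have QZr z u1 v1 : Q u1 (z *: v1) = z *: Q u1 v1.
  by rewrite -[z *: v1]addr0 Qr Q0r addr0.
have QDl u1 u2 v1 : Q (u1 + u2) v1 = Q u1 v1 + Q u2 v1.
  by rewrite -[u1 in LHS]scale1r Ql scale1r.
have QDr u1 v1 v2 : Q u1 (v1 + v2) = Q u1 v1 + Q u1 v2.
  by rewrite -[v1 in LHS]scale1r Qr scale1r.
rewrite /tens_row mulmx_suml [in RHS](row_sum_delta u).
rewrite (big_morph (fun u => Q u v) (fun u1 u2 => QDl u1 u2 v) (Q0l v)).
apply: eq_bigr => x _; rewrite mulmx_suml QZl [in RHS](row_sum_delta v).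
rewrite (big_morph (Q _) (QDr _) (Q0r _)) scaler_sumr.
by apply: eq_bigr => y _; rewrite -scalemxAl QE QZr scalerA.
Qed.

End TensorRows.

(** * The monoidal structure of the matrix category *)

Section Generators.
Variables (k : fieldType) (S : fusion_system k).
Implicit Types (a b c d e : S) (f g h : S -> nat).

Lemma sum_pair (V : nmodType) (I J : finType) (F : I * J -> V) :
  \sum_p F p = \sum_i \sum_j F (i, j).
Proof. by rewrite pair_bigA; apply: eq_bigr => -[]. Qed.

Lemma sum_tagged (V : nmodType) (I : finType) (J : I -> finType)
    (F : {i & J i} -> V) :
  \sum_p F p = \sum_i \sum_(j : J i) F (existT _ i j).
Proof. by rewrite sig_big_dep; apply: eq_bigr => -[]. Qed.

(** The types of [x'], [y'] and [l'] depend on the labels, so the Kronecker delta cannot be split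
    into one delta per index without transports. Packed into [tens_index], where [tens_ix] is
    injective, the indices isolate the term in one step. *)
Lemma sum_tens_ix_eq (V : lmodType k) f g c
    (F : forall a b, 'I_(f a) -> 'I_(g b) -> 'I_(mult a b c) -> V)
    a b (x : 'I_(f a)) (y : 'I_(g b)) (l : 'I_(mult a b c)) :
  \sum_a' \sum_b' \sum_(x' < f a') \sum_(y' < g b') \sum_(l' < mult a' b' c)
    (tens_ix x y l == tens_ix x' y' l')%:R *: F a' b' x' y' l' = F a b x y l.
Proof.
pose G (p : tens_index f g c) :=
  F (tag p).1 (tag p).2 (tagged p).1.1 (tagged p).1.2 (tagged p).2.
pose ix (p : tens_index f g c) :=
  tens_ix (tagged p).1.1 (tagged p).1.2 (tagged p).2.
have ixK : cancel ix (@tens_dec k S f g c).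
  by case=> -[a' b'] [[x' y'] l']; rewrite /ix tens_ixK.
pose p0 : tens_index f g c := existT _ (a, b) (x, y, l).
transitivity (\sum_p (ix p0 == ix p)%:R *: G p).
  rewrite sum_tagged sum_pair; apply: eq_bigr => a' _; apply: eq_bigr => b' _.
  by rewrite !sum_pair.
rewrite (bigD1 p0) //= eqxx scale1r big1 ?addr0 // => p /negPf ne.
by rewrite (can_eq ixK) eq_sym ne scale0r.
Qed.

(** Selecting one block row of the defining sum leaves the Kronecker product of row [x] of [A a] and
    row [y] of [B b]. Later proofs use this action and never the sum over matrix units. *)
Lemma tens_row_mor f f' g g' (A : mxfam k f f') (B : mxfam k g g') a b c
    (u : 'rV_(f' a)) (v : 'rV_(g' b)) (l : 'I_(mult a b c)) :
  tens_row u v l *m tens_mor A B c = tens_row (u *m A a) (v *m B b) l.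
Proof.
move: u v; apply: tens_row_mulmx => [v z u u'|u z v v'|x y].
- by rewrite mulmxDl -scalemxAl tens_rowPl.
- by rewrite mulmxDl -scalemxAl tens_rowPr.
rewrite -!rowE ffunE.
pose F a b (x : 'I_(f' a)) (y : 'I_(g' b)) (l : 'I_(mult a b c)) :=
  tens_row (row x (A a)) (row y (B b)) l.
rewrite -[RHS]/(F a b x y l) -[RHS]sum_tens_ix_eq rowE.
rewrite mulmx_sumr; apply: eq_bigr => a' _.
rewrite mulmx_sumr; apply: eq_bigr => b' _.
rewrite mulmx_sumr; apply: eq_bigr => x1 _.
rewrite mulmx_sumr.
transitivity (\sum_(y1 < g' b') \sum_(x' < f a') \sum_(y' < g b')
  \sum_(l' < mult a' b' c) (tens_ix x y l == tens_ix x1 y1 l')%:R *: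
   ((A a' x1 x' * B b' y1 y') *:
       (delta_mx 0 (tens_ix x' y' l') : 'rV[k]_(tens_obj f g c)))).
  rewrite [RHS]exchange_big /=.
  apply: eq_bigr => x' _; rewrite mulmx_sumr; apply: eq_bigr => y1 _.
  rewrite mulmx_sumr; apply: eq_bigr => y' _.
  rewrite mulmx_sumr; apply: eq_bigr => l' _.
  by rewrite -scalemxAr mul_delta_mx_cond -scaler_nat !scalerA mulrC.
apply: eq_bigr => y1 _.
under eq_bigr => x' _ do rewrite exchange_big /=.
rewrite exchange_big /=; apply: eq_bigr => l' _.
rewrite scaler_sumr; apply: eq_bigr => x' _.
rewrite scaler_sumr; apply: eq_bigr => y' _.
by rewrite !mxE.
Qed.

Definition index3l f g h d : finType :=
  {p : S * S * S & ('I_(f p.1.1) * 'I_(g p.1.2) * 'I_(h p.2)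
                    * row_index p.1.1 p.1.2 p.2 d)%type}.

Definition ix3l f g h d (p : index3l f g h d) :
    'I_(tens_obj (tens_obj f g) h d) :=
  let: existT _ (x, y, z, existT _ (i, j)) := p in
  tens_ix (tens_ix x y i) z j.

Definition dec3l f g h d (i : 'I_(tens_obj (tens_obj f g) h d)) :
    index3l f g h d :=
  let: existT (e, c) (w, z, j) := tens_dec i in
  let: existT (a, b) (x, y, i) := tens_dec w in
  existT _ (a, b, c) (x, y, z, row_ix i j).

Lemma ix3lK f g h d : cancel (@ix3l f g h d) (@dec3l f g h d).
Proof.
case=> -[[a b] c] [[[x y] z] [e [i j]]].
by rewrite /dec3l /ix3l /= !tens_ixK.
Qed.

Lemma exchange_scale (V : lmodType k) (I J : finType) (w : I -> k) (z : J -> k)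
    (X : I -> J -> V) :
  \sum_i w i *: (\sum_j z j *: X i j) = \sum_j z j *: (\sum_i w i *: X i j).
Proof.
under eq_bigr => i _ do rewrite scaler_sumr.
rewrite exchange_big; apply: eq_bigr => j _ /=.
by rewrite scaler_sumr; apply: eq_bigr => i _; rewrite !scalerA mulrC.
Qed.

Lemma tens_row_assoc_delta f g h a b c d e (x : 'I_(f a)) (y : 'I_(g b))
    (z : 'I_(h c)) (i : 'I_(mult a b e)) (j : 'I_(mult e c d)) :
  (delta_mx 0 (tens_ix (tens_ix x y i) z j) : 'rV_(tens_obj (tens_obj f g) h d))
    *m assoc_mor f g h d
  = \sum_(q : col_index a b c d) Fmat (row_ix i j) q *:
      delta_mx 0 (tens_ix x (tens_ix y z (tagged q).2) (tagged q).1).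
Proof.
pose G (p : index3l f g h d) : 'rV[k]_(tens_obj f (tens_obj g h) d) :=
  let: existT _ (x, y, z, p) := p in
  \sum_q Fmat p q *: delta_mx 0 (tens_ix x (tens_ix y z (tagged q).2) (tagged q).1).
pose p0 : index3l f g h d := existT _ (a, b, c) (x, y, z, row_ix i j).
transitivity (\sum_p (ix3l p0 == ix3l p)%:R *: G p); last first.
  rewrite (bigD1 p0) //= eqxx scale1r [X in _ + X]big1 ?addr0 // => p /negPf ne.
  by rewrite -[tens_ix _ _ _]/(ix3l p0) (can_eq (@ix3lK f g h d)) eq_sym ne scale0r.
rewrite sum_tagged !sum_pair ffunE.
rewrite mulmx_sumr; apply: eq_bigr => a' _.
rewrite mulmx_sumr; apply: eq_bigr => b' _.
rewrite mulmx_sumr; apply: eq_bigr => c' _.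
rewrite mulmx_sumr !sum_pair.
apply: eq_bigr => x' _; rewrite mulmx_sumr; apply: eq_bigr => y' _.
rewrite mulmx_sumr; apply: eq_bigr => z' _.
rewrite mulmx_sumr; apply: eq_bigr => -[e' [i' j']] _ /=.
rewrite mulmx_sumr scaler_sumr; apply: eq_bigr => q _ /=.
by rewrite -scalemxAr mul_delta_mx_cond -scaler_nat !scalerA mulrC.
Qed.

(** Both sides are trilinear in [u], [v], [w], which reduces the formula to unit vectors. It is the
    matrix form of the relation by which [F] is extracted from a category. *)
Lemma tens_row_assoc f g h a b c d e (u : 'rV_(f a)) (v : 'rV_(g b))
    (w : 'rV_(h c)) (i : 'I_(mult a b e)) (j : 'I_(mult e c d)) :
  tens_row (tens_row u v i) w j *m assoc_mor f g h d
  = \sum_(q : col_index a b c d) Fmat (row_ix i j) q *: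
      tens_row u (tens_row v w (tagged q).2) (tagged q).1.
Proof.
rewrite (row_sum_delta u) !tens_row_suml mulmx_suml_scale.
under [RHS]eq_bigr => q _ do rewrite tens_row_suml.
rewrite [RHS]exchange_scale; apply: eq_bigr => x _; congr (_ *: _).
rewrite (row_sum_delta v) tens_row_sumr tens_row_suml mulmx_suml_scale.
under [RHS]eq_bigr => q _ do rewrite tens_row_suml tens_row_sumr.
rewrite [RHS]exchange_scale; apply: eq_bigr => y _; congr (_ *: _).
rewrite (row_sum_delta w) tens_row_sumr mulmx_suml_scale.
under [RHS]eq_bigr => q _ do rewrite !tens_row_sumr.
rewrite [RHS]exchange_scale; apply: eq_bigr => z _; congr (_ *: _).
rewrite !tens_row_delta tens_row_assoc_delta.
by apply: eq_bigr => q _; rewrite !tens_row_delta.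
Qed.

Definition Fmat_invf a b c d : col_index a b c d -> row_index a b c d -> k :=
  proj1_sig (constructive_indefinite_description _ (@Fmat_inv k S a b c d)).

Lemma Fmat_invfr a b c d (p p' : row_index a b c d) :
  \sum_q Fmat p q * Fmat_invf q p' = (p == p')%:R.
Proof.
by rewrite /Fmat_invf; case: constructive_indefinite_description => G [].
Qed.

Lemma Fmat_invfl a b c d (q q' : col_index a b c d) :
  \sum_p Fmat_invf q p * Fmat p q' = (q == q')%:R.
Proof.
by rewrite /Fmat_invf; case: constructive_indefinite_description => G [].
Qed.

(** Given row by row instead of as a sum of matrix units like [assoc_mor]: each row index is decoded
    and its row is read off from the inverse of [F], so the action on rows needs no Kronecker
    deltas. *)
Definition assoc_inv f g h :
    mxfam k (tens_obj (tens_obj f g) h) (tens_obj f (tens_obj g h)) :=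
  [ffun d => \matrix_i
     let: existT (a, e) (x, w, i') := tens_dec i in
     let: existT (b, c) (y, z, j) := tens_dec w in
     \sum_p Fmat_invf (col_ix i' j) p *:
       delta_mx 0 (tens_ix (tens_ix x y (tagged p).1) z (tagged p).2)].

Lemma tens_row_assoc_inv f g h a b c d e (u : 'rV_(f a)) (v : 'rV_(g b))
    (w : 'rV_(h c)) (i : 'I_(mult a e d)) (j : 'I_(mult b c e)) :
  tens_row u (tens_row v w j) i *m assoc_inv f g h d
  = \sum_(p : row_index a b c d) Fmat_invf (col_ix i j) p *:
      tens_row (tens_row u v (tagged p).1) w (tagged p).2.
Proof.
rewrite (row_sum_delta u) !tens_row_suml mulmx_suml_scale.
under [RHS]eq_bigr => q _ do rewrite !tens_row_suml.
rewrite [RHS]exchange_scale; apply: eq_bigr => x _; congr (_ *: _).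
rewrite (row_sum_delta v) tens_row_suml tens_row_sumr mulmx_suml_scale.
under [RHS]eq_bigr => q _ do rewrite tens_row_sumr tens_row_suml.
rewrite [RHS]exchange_scale; apply: eq_bigr => y _; congr (_ *: _).
rewrite (row_sum_delta w) !tens_row_sumr mulmx_suml_scale.
under [RHS]eq_bigr => q _ do rewrite !tens_row_sumr.
rewrite [RHS]exchange_scale; apply: eq_bigr => z _; congr (_ *: _).
rewrite !tens_row_delta -rowE ffunE rowK !tens_ixK.
by apply: eq_bigr => q _; rewrite !tens_row_delta.
Qed.

Lemma sum_scale_inv (V : lmodType k) (I J : finType) (F : I -> J -> k)
    (G : J -> I -> k) (X : I -> V) i :
  (forall i', \sum_j F i j * G j i' = (i == i')%:R) ->
  \sum_j F i j *: (\sum_i' G j i' *: X i') = X i.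
Proof.
move=> FG; under eq_bigr => j _ do rewrite scaler_sumr.
rewrite exchange_big /= (bigD1 i) //= [X in _ + X]big1 => [|i' /negPf ne].
  under eq_bigr => j _ do rewrite scalerA.
  by rewrite -scaler_suml FG eqxx scale1r addr0.
under eq_bigr => j _ do rewrite scalerA.
by rewrite -scaler_suml FG eq_sym ne scale0r.
Qed.

Lemma assoc_invK f g h :
  mxfam_comp (assoc_mor f g h) (assoc_inv f g h) = mxfam_id k _.
Proof.
apply/ffunP => d; rewrite mxfam_compE mxfam_idE.
apply: tens_row_extl => a b c e u v w i j.
rewrite mulmxA mulmx1. rewrite tens_row_assoc mulmx_suml_scale.
rewrite -[RHS](sum_scale_inv (G := @Fmat_invf a b c d)
  (fun p => tens_row (tens_row u v (tagged p).1) w (tagged p).2)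
  (@Fmat_invfr a b c d (row_ix i j))) /=.
by apply: eq_bigr => -[e' [i' j']] _; rewrite tens_row_assoc_inv.
Qed.

Lemma assoc_morK f g h :
  mxfam_comp (assoc_inv f g h) (assoc_mor f g h) = mxfam_id k _.
Proof.
apply/ffunP => d; rewrite mxfam_compE mxfam_idE.
apply: tens_row_extr => a b c e u v w i j.
rewrite mulmxA mulmx1 tens_row_assoc_inv mulmx_suml_scale.
rewrite -[RHS](sum_scale_inv (F := @Fmat_invf a b c d)
  (fun q => tens_row u (tens_row v w (tagged q).2) (tagged q).1)
  (@Fmat_invfl a b c d (col_ix i j))) /=.
by apply: eq_bigr => -[e' [i' j']] _; rewrite tens_row_assoc.
Qed.
End Generators.

(** * Simple objects and unit isomorphisms on rows *)

Section Units.
Variables (k : fieldType) (S : fusion_system k).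
Implicit Types (a b c d e : S) (f g h : S -> nat).

Lemma index1_unique n (n1 : n = 1%N) (i : 'I_n) : i = index1 n1.
Proof.
by apply/val_inj => /=; move: (ltn_ord i); rewrite {2}n1; case: (val i).
Qed.

Lemma simple_ix_eq a b : 'I_(simple_obj a b) -> a = b.
Proof. by move=> r; apply/eqP; move: r; rewrite /simple_obj; case: eqP => // _ []. Qed.

(** An index of [simple_obj a b] forces [b] to be [a]. As an indexed family the view substitutes
    label and index together, which avoids transports along [a = b]; the two views for products with
    [one] below work in the same way. *)
Variant simple_ix_spec a : forall b, 'I_(simple_obj a b) -> Prop :=
  SimpleIx : simple_ix_spec (simple_ix a).

Lemma simple_ixP a b (r : 'I_(simple_obj a b)) : simple_ix_spec r.
Proof.
by case: _ / (simple_ix_eq r) (r) => r'; rewrite (index1_unique (simple_obj_diag a) r').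
Qed.

Lemma idx1l_eq a b : 'I_(mult one a b) -> a = b.
Proof. by move=> i; apply/eqP; move: i; rewrite mult1l; case: eqP => // _ []. Qed.

Variant idx1l_spec a : forall b, 'I_(mult one a b) -> Prop :=
  Idx1l : idx1l_spec (idx1l a).

Lemma idx1lP a b (i : 'I_(mult one a b)) : idx1l_spec i.
Proof.
by case: _ / (idx1l_eq i) (i) => i'; rewrite (index1_unique (mult1l_diag a) i').
Qed.

Lemma idx1r_eq a b : 'I_(mult a one b) -> a = b.
Proof. by move=> i; apply/eqP; move: i; rewrite mult1r; case: eqP => // _ []. Qed.

Variant idx1r_spec a : forall b, 'I_(mult a one b) -> Prop :=
  Idx1r : idx1r_spec (idx1r a).

Lemma idx1rP a b (i : 'I_(mult a one b)) : idx1r_spec i.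
Proof.
by case: _ / (idx1r_eq i) (i) => i'; rewrite (index1_unique (mult1r_diag a) i').
Qed.

Definition simple_row a : 'rV[k]_(simple_obj a a) := delta_mx 0 (simple_ix a).

Lemma row_lunit f c (u : 'rV_(f c)) :
  u *m lunit_mor f c = tens_row (simple_row one) u (idx1l c).
Proof.
rewrite ffunE [in RHS](row_sum_delta u) tens_row_sumr mulmx_sumr.
apply: eq_bigr => y _.
rewrite tens_row_delta; apply/rowP => j; rewrite !mxE (bigD1 y) //= !mxE eqxx.
rewrite big1 ?addr0 ?eqxx //= => y' /negPf ne; rewrite !mxE ne mulr0 //.
Qed.

Lemma row_runit f c (u : 'rV_(f c)) :
  u *m runit_mor f c = tens_row u (simple_row one) (idx1r c).
Proof.
rewrite ffunE [in RHS](row_sum_delta u) tens_row_suml mulmx_sumr.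
apply: eq_bigr => y _.
rewrite tens_row_delta; apply/rowP => j; rewrite !mxE (bigD1 y) //= !mxE eqxx.
rewrite big1 ?addr0 ?eqxx //= => y' /negPf ne; rewrite !mxE ne mulr0 //.
Qed.

(** Only one block is nonempty: an index of [simple_obj one a] forces [a = one], and an index of
    [mult one b c] forces [b = c]. *)
Lemma tens_row_ext1l f c n (M N : 'M[k]_(tens_obj (simple_obj one) f c, n)) :
  (forall u : 'rV_(f c), tens_row (simple_row one) u (idx1l c) *m M
                         = tens_row (simple_row one) u (idx1l c) *m N) -> M = N.
Proof.
move=> eqMN; apply/row_matrixP => i; case: (tens_ixP i) => a b x y l.
rewrite !rowE -tens_row_delta; case: (simple_ixP x) l => l.
by case: (idx1lP l) M N eqMN => M N ->.
Qed.

Lemma tens_row_ext1r f c n (M N : 'M[k]_(tens_obj f (simple_obj one) c, n)) :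
  (forall u : 'rV_(f c), tens_row u (simple_row one) (idx1r c) *m M
                         = tens_row u (simple_row one) (idx1r c) *m N) -> M = N.
Proof.
move=> eqMN; apply/row_matrixP => i; case: (tens_ixP i) => a b x y l.
rewrite !rowE -tens_row_delta; case: (simple_ixP y) l => l.
by case: (idx1rP l) M N eqMN => M N ->.
Qed.

End Units.

Section Monoidal.
Variables (k : fieldType) (S : fusion_system k).
Implicit Types (a b c d e : S) (f g h : S -> nat).

Lemma tens_ix_inj f g a b c (x x' : 'I_(f a)) (y y' : 'I_(g b))
    (l l' : 'I_(mult a b c)) :
  tens_ix x y l = tens_ix x' y' l' -> (x, y, l) = (x', y', l').
Proof.
move/(congr1 (@tens_dec _ _ _ _ _)); rewrite !tens_ixK => /eqP.
by rewrite eq_Tagged => /eqP.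
Qed.

(** In each degree [lunit_mor] is a permutation matrix, so its inverse is its transpose. *)
Definition lunit_inv f : mxfam k f (tens_obj (simple_obj one) f) :=
  [ffun c => (lunit_mor f c)^T].
Definition runit_inv f : mxfam k f (tens_obj f (simple_obj one)) :=
  [ffun c => (runit_mor f c)^T].

Lemma lunit_morK f c : lunit_mor f c *m lunit_inv f c = 1%:M.
Proof.
rewrite [lunit_inv f c]ffunE; apply/matrixP => y y'; rewrite !mxE.
have rowL z : row z (lunit_mor f c) = delta_mx 0 (tens_ix (simple_ix one) z (idx1l c)).
  by rewrite rowE row_lunit tens_row_delta.
have entL z j : lunit_mor f c z j = (j == tens_ix (simple_ix one) z (idx1l c))%:R.
  by move/rowP/(_ j): (rowL z); rewrite !mxE eqxx.
rewrite (bigD1 (tens_ix (simple_ix one) y (idx1l c))) //= mxE !entL eqxx mul1r.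
rewrite big1 ?addr0 => [|j /negPf ne]; last by rewrite entL ne mul0r.
have [->|ne] := eqVneq y y'; first by rewrite eqxx.
by case: eqP => // /tens_ix_inj [] /eqP; rewrite (negPf ne).
Qed.

Lemma runit_morK f c : runit_mor f c *m runit_inv f c = 1%:M.
Proof.
rewrite [runit_inv f c]ffunE; apply/matrixP => y y'; rewrite !mxE.
have rowR z : row z (runit_mor f c) = delta_mx 0 (tens_ix z (simple_ix one) (idx1r c)).
  by rewrite rowE row_runit tens_row_delta.
have entR z j : runit_mor f c z j = (j == tens_ix z (simple_ix one) (idx1r c))%:R.
  by move/rowP/(_ j): (rowR z); rewrite !mxE eqxx.
rewrite (bigD1 (tens_ix y (simple_ix one) (idx1r c))) //= mxE !entR eqxx mul1r.
rewrite big1 ?addr0 => [|j /negPf ne]; last by rewrite entR ne mul0r.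
have [->|ne] := eqVneq y y'; first by rewrite eqxx.
by case: eqP => // /tens_ix_inj [] /eqP; rewrite (negPf ne).
Qed.

Local Notation C := (system_category S).

Lemma system_lunit_iso f : is_iso (lunit (f : C)).
Proof.
exists (lunit_inv f); split; apply/ffunP => c; rewrite mxfam_compE mxfam_idE.
  (* The test rows are the products [u *m lunit_mor f c], so this composite follows from
     [lunit_morK] and associativity of the matrix product. *)
  apply: tens_row_ext1l => u; rewrite -row_lunit mulmxA -(mulmxA u).
  by rewrite lunit_morK !mulmx1.
exact: lunit_morK.
Qed.

Lemma system_runit_iso f : is_iso (runit (f : C)).
Proof.
exists (runit_inv f); split; apply/ffunP => c; rewrite mxfam_compE mxfam_idE.
  apply: tens_row_ext1r => u; rewrite -row_runit mulmxA -(mulmxA u).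
  by rewrite runit_morK !mulmx1.
exact: runit_morK.
Qed.

Lemma system_category_ax : is_category C /\ is_linear_category C.
Proof.
split; split.
- by move=> f g A; apply/ffunP => a; rewrite mxfam_compE mxfam_idE mul1mx.
- by move=> f g A; apply/ffunP => a; rewrite mxfam_compE mxfam_idE mulmx1.
- by move=> f g h h' A B D; apply/ffunP => a; rewrite !mxfam_compE mulmxA.
- move=> f g h B z A A'; apply/ffunP => a.
  by rewrite mxfam_linE !mxfam_compE mxfam_linE mulmxDr scalemxAr.
- move=> f g h A z B B'; apply/ffunP => a.
  by rewrite mxfam_linE !mxfam_compE mxfam_linE mulmxDl scalemxAl.
Qed.

Lemma system_tensor_bilinear : is_tensor_bilinear C.
Proof.
split.
  move=> f f' g g' A z B B'; apply/ffunP => c.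
  apply: tens_row_ext => a b u v l.
  rewrite mxfam_linE mulmxDr -scalemxAr !tens_row_mor mxfam_linE.
  by rewrite mulmxDr -scalemxAr tens_rowPr.
move=> f f' g g' B z A A'; apply/ffunP => c.
apply: tens_row_ext => a b u v l.
rewrite mxfam_linE mulmxDr -scalemxAr !tens_row_mor mxfam_linE.
by rewrite mulmxDr -scalemxAr tens_rowPl.
Qed.

Lemma pentagon_lhs (V : lmodType k) (a b c d e f u : S) (i : 'I_(mult a b e))
    (j : 'I_(mult e c f)) (r : 'I_(mult f d u))
    (X : forall g h : S, 'I_(mult a h u) -> 'I_(mult b g h) -> 'I_(mult c d g) -> V) :
  \sum_(q : col_index e c d u) Fmat (row_ix j r) q *:
    (\sum_(q' : col_index a b (tag q) u) Fmat (row_ix i (tagged q).1) q' *: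
       X (tag q) (tag q') (tagged q').1 (tagged q').2 (tagged q).2)
  = \sum_(h : S) \sum_(n < mult a h u) \sum_(g : S)
    \sum_(o < mult b g h) \sum_(m < mult c d g)
      (\sum_(l < mult e g u)
         Fmat (row_ix j r) (col_ix l m) * Fmat (row_ix i l) (col_ix n o))
      *: X g h n o m.
Proof.
under eq_bigr => q _ do rewrite scaler_sumr sum_tagged.
rewrite exchange_big; apply: eq_bigr => h _ /=.
under eq_bigr => q _ do rewrite sum_pair.
rewrite exchange_big; apply: eq_bigr => n _ /=.
rewrite sum_tagged; apply: eq_bigr => g _; rewrite sum_pair /=.
under eq_bigr => l _ do rewrite exchange_big /=.
rewrite exchange_big; apply: eq_bigr => o _ /=.
rewrite exchange_big; apply: eq_bigr => m _ /=.
by rewrite scaler_suml; apply: eq_bigr => l _; rewrite scalerA.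
Qed.

Lemma pentagon_rhs (V : lmodType k) (a b c d e f u : S) (i : 'I_(mult a b e))
    (j : 'I_(mult e c f)) (r : 'I_(mult f d u))
    (X : forall g h : S, 'I_(mult a h u) -> 'I_(mult b g h) -> 'I_(mult c d g) -> V) :
  \sum_(q1 : col_index a b c f) Fmat (row_ix i j) q1 *:
    (\sum_(q2 : col_index a (tag q1) d u) Fmat (row_ix (tagged q1).1 r) q2 *:
      (\sum_(q3 : col_index b c d (tag q2))
         Fmat (row_ix (tagged q1).2 (tagged q2).2) q3 *:
       X (tag q3) (tag q2) (tagged q2).1 (tagged q3).1 (tagged q3).2))
  = \sum_(h : S) \sum_(n < mult a h u) \sum_(g : S)
    \sum_(o < mult b g h) \sum_(m < mult c d g)
      (\sum_(q : S) \sum_(p < mult a q f) \sum_(s < mult b c q) \sum_(v < mult q d h)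
         Fmat (row_ix i j) (col_ix p s) * Fmat (row_ix p r) (col_ix n v)
         * Fmat (row_ix s v) (col_ix o m)) *: X g h n o m.
Proof.
under eq_bigr => q1 _ do rewrite scaler_sumr sum_tagged.
rewrite exchange_big; apply: eq_bigr => h _ /=.
under eq_bigr => q1 _ do rewrite sum_pair.
rewrite exchange_big; apply: eq_bigr => n _ /=.
under eq_bigr => q1 _.
  under eq_bigr => v _ do rewrite !scaler_sumr sum_tagged.
  rewrite exchange_big; over.
rewrite exchange_big; apply: eq_bigr => g _ /=.
under eq_bigr => q1 _.
  under eq_bigr => v _ do rewrite sum_pair.
  rewrite exchange_big; over.
rewrite exchange_big; apply: eq_bigr => o _ /=.
under eq_bigr => q1 _ do rewrite exchange_big.
rewrite exchange_big; apply: eq_bigr => m _ /=.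
rewrite sum_tagged scaler_suml; apply: eq_bigr => q _.
rewrite sum_pair scaler_suml; apply: eq_bigr => p _.
rewrite scaler_suml; apply: eq_bigr => s _.
rewrite scaler_suml; apply: eq_bigr => v _.
by rewrite !scalerA.
Qed.

(** Acting on fully left-bracketed rows, the left side re-brackets with two factors [F] and the
    right side with three; both end in fully right-bracketed rows. *)
Lemma system_pentagon (x y z w : C) :
  assoc (x \ot y) z w \oc assoc x y (z \ot w)
  = (assoc x y z \om idm w) \oc assoc x (y \ot z) w \oc (idm x \om assoc y z w).
Proof.
apply/ffunP => u; rewrite !mxfam_compE.
apply: tens_row_extll => a b c d e f ra rb rc rd i j r.
rewrite !mulmxA.
rewrite tens_row_assoc tens_row_mor mxfam_idE mulmx1 tens_row_assoc.
rewrite tens_row_suml !mulmx_suml_scale.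
pose X (g h : S) (n : 'I_(mult a h u)) (o : 'I_(mult b g h)) (m : 'I_(mult c d g)) :=
  tens_row ra (tens_row rb (tens_row rc rd m) o) n.
transitivity (\sum_(q : col_index e c d u) Fmat (row_ix j r) q *:
    (\sum_(q' : col_index a b (tag q) u) Fmat (row_ix i (tagged q).1) q' *:
       X (tag q) (tag q') (tagged q').1 (tagged q').2 (tagged q).2)).
  by apply: eq_bigr => q _; rewrite tens_row_assoc.
rewrite pentagon_lhs.
transitivity (\sum_(q1 : col_index a b c f) Fmat (row_ix i j) q1 *:
    (\sum_(q2 : col_index a (tag q1) d u) Fmat (row_ix (tagged q1).1 r) q2 *:
      (\sum_(q3 : col_index b c d (tag q2))
         Fmat (row_ix (tagged q1).2 (tagged q2).2) q3 *:
       X (tag q3) (tag q2) (tagged q2).1 (tagged q3).1 (tagged q3).2))).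
  rewrite pentagon_rhs.
  do 5![apply: eq_bigr => ? _].
  by rewrite Fmat_pentagon.
apply: eq_bigr => q1 _; rewrite tens_row_assoc mulmx_suml_scale.
congr (_ *: _); apply: eq_bigr => q2 _.
by rewrite tens_row_mor mxfam_idE mulmx1 tens_row_assoc tens_row_sumr.
Qed.

Lemma tens_mor_comp f f' f'' g g' g'' (A : mxfam k f f') (A' : mxfam k f' f'')
    (B : mxfam k g g') (B' : mxfam k g' g'') :
  tens_mor (mxfam_comp A' A) (mxfam_comp B' B)
  = mxfam_comp (tens_mor A' B') (tens_mor A B).
Proof.
apply/ffunP => c; apply: tens_row_ext => a b u v l.
by rewrite tens_row_mor !mxfam_compE !mulmxA !tens_row_mor.
Qed.

Lemma assoc_mor_natural f f' g g' h h' (A : mxfam k f f') (B : mxfam k g g')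
    (D : mxfam k h h') :
  mxfam_comp (assoc_mor f' g' h') (tens_mor A (tens_mor B D))
  = mxfam_comp (tens_mor (tens_mor A B) D) (assoc_mor f g h).
Proof.
apply/ffunP => d; rewrite !mxfam_compE.
apply: tens_row_extl => a b c e u v w i j.
rewrite !mulmxA tens_row_assoc !tens_row_mor tens_row_assoc mulmx_suml_scale.
by apply: eq_bigr => q _; rewrite !tens_row_mor.
Qed.

Lemma lunit_mor_natural f g (A : mxfam k f g) :
  mxfam_comp (lunit_mor g) (tens_mor (mxfam_id k (simple_obj one)) A)
  = mxfam_comp A (lunit_mor f).
Proof.
apply/ffunP => c; rewrite !mxfam_compE; apply/row_matrixP => i.
by rewrite !rowE !mulmxA !row_lunit tens_row_mor mxfam_idE mulmx1.
Qed.

Lemma runit_mor_natural f g (A : mxfam k f g) :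
  mxfam_comp (runit_mor g) (tens_mor A (mxfam_id k (simple_obj one)))
  = mxfam_comp A (runit_mor f).
Proof.
apply/ffunP => c; rewrite !mxfam_compE; apply/row_matrixP => i.
by rewrite !rowE !mulmxA !row_runit tens_row_mor mxfam_idE mulmx1.
Qed.

(** On rows the claim is that [F] with middle label [one] is the identity matrix: an index of
    [mult one b e] exists only for [e = b], and [Fmat_one] then leaves the single term with
    [i = l]. *)
Lemma system_triangle f g :
  mxfam_comp (tens_mor (runit_mor f) (mxfam_id k g))
             (assoc_mor f (simple_obj one) g)
  = tens_mor (mxfam_id k f) (lunit_mor g).
Proof.
apply/ffunP => d; rewrite mxfam_compE.
apply: tens_row_ext => a b u v l.
rewrite mulmxA !tens_row_mor !mxfam_idE !mulmx1 row_runit row_lunit tens_row_assoc.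
rewrite sum_tagged (bigD1 b) //= [X in _ + X]big1 ?addr0 => [|e ne]; last first.
  by rewrite big1 // => -[i j] _; rewrite (idx1l_eq j) eqxx in ne.
rewrite sum_pair (bigD1 l) //= [X in _ + X]big1 ?addr0 => [|i /negPf ne]; last first.
  rewrite big1 // => j _ /=.
  by rewrite (index1_unique (mult1l_diag b) j) Fmat_one eq_sym ne scale0r.
rewrite (bigD1 (idx1l b)) //= big1 ?addr0 => [|j]; last first.
  by rewrite (index1_unique (mult1l_diag b) j) eqxx.
by rewrite Fmat_one eqxx scale1r.
Qed.

Lemma system_assoc_iso (x y z : C) : is_iso (assoc x y z).
Proof. by exists (assoc_inv x y z); split; [exact: assoc_morK | exact: assoc_invK]. Qed.

Lemma system_monoidal : is_monoidal C.
Proof.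
split.
- split=> [x y|x x' x'' y y' y'' f f' g g'].
    apply/ffunP => c; apply: tens_row_ext => a b u v l.
    by rewrite tens_row_mor !mxfam_idE !mulmx1.
  exact: tens_mor_comp.
- split; [exact: system_assoc_iso|exact: system_lunit_iso|exact: system_runit_iso].
- split=> [x x' y y' z z' f g h|x y f|x y f].
  + exact: assoc_mor_natural.
  + exact: lunit_mor_natural.
  + exact: runit_mor_natural.
- exact: system_pentagon.
- exact: system_triangle.
Qed.

End Monoidal.

(** * Coherence and the transposed zig-zag identity *)

Section Coherence.
Variables (k : fieldType) (C : moncat_data k).
Hypotheses (Ccat : is_category C) (Cmon : is_monoidal C).
Implicit Types x y z w : C.

Lemma comp1m x y (f : hom x y) : idm y \oc f = f.
Proof. by case: Ccat => H _ _; exact: H. Qed.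

Lemma compm1 x y (f : hom x y) : f \oc idm x = f.
Proof. by case: Ccat => _ H _; exact: H. Qed.

Lemma compmA x y z w (f : hom x y) (g : hom y z) (h : hom z w) :
  h \oc (g \oc f) = h \oc g \oc f.
Proof. by case: Ccat => _ _ H; exact: H. Qed.

Lemma iso_epi x y z (f : hom x y) (g h : hom y z) :
  is_iso f -> g \oc f = h \oc f -> g = h.
Proof.
case=> f' [_ ff'] /(congr1 (fun p => p \oc f')).
by rewrite -!compmA ff' !compm1.
Qed.

Lemma iso_mono x y z (f : hom y z) (g h : hom x y) :
  is_iso f -> f \oc g = f \oc h -> g = h.
Proof.
case=> f' [f'f _] /(congr1 (fun p => f' \oc p)).
by rewrite !compmA f'f !comp1m.
Qed.

Lemma inverse_sym x y (f : hom x y) g : inverse_pair f g -> inverse_pair g f.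
Proof. by case. Qed.

Lemma is_iso_id x : is_iso (idm x).
Proof. by exists (idm x); split; rewrite comp1m. Qed.

Lemma is_iso_comp x y z (f : hom x y) (g : hom y z) :
  is_iso f -> is_iso g -> is_iso (g \oc f).
Proof.
move=> [f' [f'f ff']] [g' [g'g gg']]; exists (f' \oc g'); split.
  by rewrite -compmA (compmA f) g'g comp1m.
by rewrite -compmA (compmA g') ff' comp1m.
Qed.

Lemma tensm_id x y : idm x \om idm y = idm (x \ot y).
Proof. by case: Cmon => -[H _] *; exact: H. Qed.

Lemma tensm_comp x x' x'' y y' y'' (f : hom x x') (f' : hom x' x'')
    (g : hom y y') (g' : hom y' y'') :
  (f' \oc f) \om (g' \oc g) = (f' \om g') \oc (f \om g).
Proof. by case: Cmon => -[_ H] *; exact: H. Qed.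

Lemma assoc_iso x y z : is_iso (assoc x y z).
Proof. by case: Cmon => _ [H _ _] *; exact: H. Qed.

Lemma lunit_iso x : is_iso (lunit x).
Proof. by case: Cmon => _ [_ H _] *; exact: H. Qed.

Lemma runit_iso x : is_iso (runit x).
Proof. by case: Cmon => _ [_ _ H] *; exact: H. Qed.

Lemma assoc_natural x x' y y' z z' (f : hom x x') (g : hom y y') (h : hom z z') :
  assoc x' y' z' \oc (f \om (g \om h)) = ((f \om g) \om h) \oc assoc x y z.
Proof. by case: Cmon => _ _ [H _ _] *; exact: H. Qed.

Lemma lunit_natural x y (f : hom x y) :
  lunit y \oc (idm unit_obj \om f) = f \oc lunit x.
Proof. by case: Cmon => _ _ [_ H _] *; exact: H. Qed.

Lemma runit_natural x y (f : hom x y) :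
  runit y \oc (f \om idm unit_obj) = f \oc runit x.
Proof. by case: Cmon => _ _ [_ _ H] *; exact: H. Qed.

Lemma pentagon x y z w :
  assoc (x \ot y) z w \oc assoc x y (z \ot w)
  = (assoc x y z \om idm w) \oc assoc x (y \ot z) w \oc (idm x \om assoc y z w).
Proof. by case: Cmon. Qed.

Lemma triangle x y :
  (runit x \om idm y) \oc assoc x unit_obj y = idm x \om lunit y.
Proof. by case: Cmon. Qed.

Lemma tensm_idr_comp x y z w (f : hom x y) (g : hom y z) :
  (g \oc f) \om idm w = (g \om idm w) \oc (f \om idm w).
Proof. by rewrite -tensm_comp comp1m. Qed.

Lemma tensm_idl_comp x y z w (f : hom x y) (g : hom y z) :
  idm w \om (g \oc f) = (idm w \om g) \oc (idm w \om f).
Proof. by rewrite -tensm_comp comp1m. Qed.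

Lemma is_iso_tens x x' y y' (f : hom x x') (g : hom y y') :
  is_iso f -> is_iso g -> is_iso (f \om g).
Proof.
move=> [f' [f'f ff']] [g' [g'g gg']]; exists (f' \om g').
by split; rewrite -tensm_comp ?f'f ?g'g ?ff' ?gg' tensm_id.
Qed.

Lemma unit_tens_faithful x y (f g : hom x y) :
  idm unit_obj \om f = idm unit_obj \om g -> f = g.
Proof.
move=> fg; apply: iso_epi (lunit_iso x) _.
by rewrite -!lunit_natural fg.
Qed.

Lemma tens_unit_faithful x y (f g : hom x y) :
  f \om idm unit_obj = g \om idm unit_obj -> f = g.
Proof.
move=> fg; apply: iso_epi (runit_iso x) _.
by rewrite -!runit_natural fg.
Qed.

(** Kelly's argument: tensoring with the unit is faithful because [lunit] is natural and invertible,
    and after tensoring the claim follows from the pentagon at [unit_obj], [unit_obj], [x], [y] and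
    two triangles. *)
Lemma lunit_tens x y :
  lunit (x \ot y) = (lunit x \om idm y) \oc assoc unit_obj x y.
Proof.
apply: unit_tens_faithful; apply: iso_mono (assoc_iso unit_obj x y) _.
rewrite -triangle -tensm_id compmA assoc_natural -compmA pentagon.
rewrite !compmA -tensm_idr_comp triangle.
by rewrite -assoc_natural -compmA -tensm_idl_comp.
Qed.

Lemma runit_tens x y :
  runit (x \ot y) \oc assoc x y unit_obj = idm x \om runit y.
Proof.
apply: tens_unit_faithful.
apply: (iso_epi (is_iso_comp (is_iso_tens (is_iso_id x) (assoc_iso y unit_obj unit_obj))
  (assoc_iso x (y \ot unit_obj) unit_obj))).
rewrite tensm_idr_comp -!compmA.
rewrite [X in _ \oc X = _]compmA -[X in _ \oc X = _]pentagon.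
rewrite compmA triangle -tensm_id -assoc_natural -triangle tensm_idl_comp.
by rewrite compmA assoc_natural -compmA.
Qed.

(** After tensoring with the unit, the triangle turns [runit] into
    [idm unit_obj \om lunit unit_obj], and [lunit_tens] turns [lunit] into
    [lunit (unit_obj \ot unit_obj)]. These agree by naturality of [lunit] at [lunit unit_obj]. *)
Lemma lunit_runit_unit : lunit (unit_obj : C) = runit unit_obj.
Proof.
apply: tens_unit_faithful; apply: iso_epi (assoc_iso unit_obj unit_obj unit_obj) _.
rewrite triangle -lunit_tens.
by apply: iso_mono (lunit_iso unit_obj) _; rewrite lunit_natural.
Qed.

(* Up to coherence, both composites are [e \om e] precomposed with [c]
   inserted in the middle of [x \ot x']. *)
Lemma zigzag_transpose x x' (c : hom unit_obj (x' \ot x))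
    (e : hom (x \ot x') unit_obj) ai :
  lunit x \oc (e \om idm x) \oc assoc x x' x \oc (idm x \om c) = runit x ->
  inverse_pair (assoc x' x x') ai ->
  e \oc (idm x \om (runit x' \oc (idm x' \om e) \oc ai \oc (c \om idm x')))
  = e \oc (idm x \om lunit x').
Proof.
move=> zig [aiK Kai].
pose mid := assoc x x' (x \ot x') \oc (idm x \om ai) \oc (idm x \om (c \om idm x')).
(* The evaluations act on disjoint factors: [e \om e] splits with the right-hand evaluation first in
   this half, and with the left-hand one first in the second half. *)
transitivity (lunit unit_obj \oc (e \om e) \oc mid).
  rewrite lunit_runit_unit !tensm_idl_comp -runit_tens.
  rewrite /mid !compmA -runit_natural -[e \om e]compm1.
  have -> : e \om e = (e \om idm unit_obj) \oc (idm (x \ot x') \om e).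
    by rewrite -tensm_comp comp1m compm1.
  rewrite compm1; do 2![congr (_ \oc _)].
  rewrite -!compmA; do 2![congr (_ \oc _)].
  by rewrite -tensm_id assoc_natural.
(* The hypothesis [zig] enters here: the triangle turns [idm x \om lunit x'] into a composite
   containing [runit x], which is replaced by the zig-zag composite. *)
rewrite -triangle -zig !tensm_idr_comp.
rewrite !compmA -[_ \oc assoc x unit_obj x']compmA -assoc_natural.
have pent : (assoc x x' x \om idm x') \oc assoc x (x' \ot x) x'
    = assoc (x \ot x') x x' \oc assoc x x' (x \ot x') \oc (idm x \om ai).
  by rewrite pentagon -compmA -tensm_idl_comp Kai tensm_id compm1.
rewrite compmA -(compmA _ (assoc x x' x \om idm x')) pent.
rewrite /mid !compmA; do 3![congr (_ \oc _)].
rewrite -[in RHS]compmA -assoc_natural tensm_id.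
rewrite compmA -[in RHS](compmA _ _ e) -lunit_tens.
rewrite -lunit_natural -compmA; congr (_ \oc _).
by rewrite -tensm_comp comp1m compm1.
Qed.

End Coherence.

(** * Duals in the matrix category *)

Section Duals.
Variables (k : fieldType) (S : fusion_system k).
Implicit Types (a b c d e : S) (f g h : S -> nat).
Local Notation C := (system_category S).

Lemma idx_dualr_eq a b : 'I_(mult a b one) -> b = dual a.
Proof.
by move=> i; apply/eqP; move: i; rewrite mult_one eq_sym; case: eqP => // _ [].
Qed.

(** The constraint [b == dual a] of [ev_mor] disappears because [mult a b one] has no index
    otherwise; the sum then ranges over all labels [b]. *)
Lemma ev_row f :
  simple_row (one : S) *m ev_mor f one
  = \sum_a \sum_b \sum_(x < f a) \sum_(y < dual_obj f b | x == y :> nat)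
      \sum_(l < mult a b one)
        tens_row (delta_mx 0 x : 'rV[k]_(f a)) (delta_mx 0 y : 'rV_(dual_obj f b)) l.
Proof.
rewrite ffunE (bigD1 (simple_ix one)) //= [X in _ + X]big1 ?addr0 => [|r]; last first.
  by rewrite (index1_unique (simple_obj_diag (one : S)) r) eqxx.
rewrite mulmx_sumr; apply: eq_bigr => a _.
rewrite [RHS](bigID (fun b => b == dual a)) /= [X in _ = _ + X]big1 ?addr0.
  rewrite mulmx_sumr; apply: eq_bigr => b _.
  rewrite mulmx_sumr; apply: eq_bigr => x _.
  rewrite mulmx_sumr; apply: eq_bigr => y _.
  rewrite mulmx_sumr; apply: eq_bigr => l _.
  by rewrite mul_delta_mx tens_row_delta.
move=> b ne; apply: big1 => x _; apply: big1 => y _; apply: big1 => l _.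
by rewrite (idx_dualr_eq l) eqxx in ne.
Qed.

Lemma coev_row f a (x : 'I_(f a)) (y : 'I_(dual_obj f (dual a))) (u : 'rV[k]_(f a)) :
  x = y :> nat ->
  tens_row (delta_mx 0 y : 'rV[k]_(dual_obj f (dual a))) u (idx_duall a)
    *m coev_mor f one
  = (u 0 x / dual_scalar a) *: simple_row (one : S).
Proof.
move=> xy; rewrite [in LHS](row_sum_delta u) tens_row_sumr mulmx_suml_scale.
(* [F] extends the coefficient by zero to the blocks and copies that [coev_mor] does not pair, so
   that [sum_tens_ix_eq] applies to unrestricted sums. *)
pose F b a' (y : 'I_(dual_obj f b)) (x : 'I_(f a')) (l : 'I_(mult b a' one)) :=
  if b == dual a' then if x == y :> nat then
    (dual_scalar a')^-1 *: simple_row (one : S) else 0 else 0.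
have rowF z : tens_row (delta_mx 0 y : 'rV[k]_(dual_obj f (dual a))) (delta_mx 0 z)
    (idx_duall a) *m coev_mor f one = F _ _ y z (idx_duall a).
  rewrite tens_row_delta -[RHS]sum_tens_ix_eq ffunE.
  rewrite (bigD1 (simple_ix one)) //= [X in _ + X]big1 ?addr0 => [|r]; last first.
    by rewrite (index1_unique (simple_obj_diag (one : S)) r) eqxx.
  rewrite exchange_big /= mulmx_sumr; apply: eq_bigr => a' _.
  rewrite mulmx_sumr big_mkcond; apply: eq_bigr => b' _ /=.
  rewrite exchange_big /=.
  have [bE|bE] := eqVneq b' (dual a'); last first.
    rewrite big1 // => x' _; rewrite big1 // => y' _; rewrite big1 // => l' _.
    by rewrite /F (negPf bE) scaler0.
  have bT : b' == dual a' by rewrite bE.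
  rewrite mulmx_sumr; apply: eq_bigr => x' _.
  rewrite mulmx_sumr big_mkcond; apply: eq_bigr => y' _ /=.
  rewrite /F bT; case: ifP => _; last first.
    by rewrite big1 // => l' _; rewrite scaler0.
  rewrite mulmx_sumr; apply: eq_bigr => l' _.
  by rewrite -scalemxAr mul_delta_mx_cond -scaler_nat !scalerA mulrC.
rewrite (bigD1 x) //= [X in _ + X]big1 ?addr0 => [|z zx].
  by rewrite rowF /F eqxx xy eqxx scalerA.
rewrite rowF /F eqxx; case: eqP => [zy|_]; last by rewrite scaler0.
by case/eqP: zx; apply: val_inj; rewrite /= zy.
Qed.


(* The entries of [Q] are the coefficients of [ev \oc (1 \om Q)] on the blocks
   [(dual c, c)]. *)
Lemma ev_nondegenerate f h (M N : mxfam k h (dual_obj f)) :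
  mxfam_comp (ev_mor f) (tens_mor (mxfam_id k f) M)
  = mxfam_comp (ev_mor f) (tens_mor (mxfam_id k f) N) -> M = N.
Proof.
have entry (Q : mxfam k h (dual_obj f)) c (y : 'I_(dual_obj f c)) j :
    (simple_row (one : S)
       *m mxfam_comp (ev_mor f) (tens_mor (mxfam_id k f) Q) one)
      0 (tens_ix (y : 'I_(f (dual c))) j (idx_duall c))
    = Q c y j.
  pose F a b (x : 'I_(f a)) (z : 'I_(h b)) (l : 'I_(mult a b one)) : k^o :=
    \sum_(y' < dual_obj f b | x == y' :> nat) Q b y' z.
  transitivity (F _ _ (y : 'I_(f (dual c))) j (idx_duall c)); last first.
    by rewrite /F (big_pred1 y) // => y' /=; rewrite eq_sym.
  rewrite -[RHS]sum_tens_ix_eq mxfam_compE mulmxA ev_row.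
  rewrite mulmx_suml summxE; apply: eq_bigr => a _.
  rewrite mulmx_suml summxE; apply: eq_bigr => b _.
  rewrite mulmx_suml summxE; apply: eq_bigr => x _.
  rewrite mulmx_suml summxE.
  under eq_bigr => y' _.
    rewrite mulmx_suml summxE.
    under eq_bigr => l _ do rewrite tens_row_mor mxfam_idE mulmx1
      (row_sum_delta (_ *m Q b)) tens_row_sumr summxE.
    rewrite exchange_big /=; over.
  rewrite exchange_big; apply: eq_bigr => z _ /=.
  rewrite exchange_big; apply: eq_bigr => l _ /=.
  rewrite /F scaler_sumr; apply: eq_bigr => y' _.
  rewrite tens_row_delta mxE -rowE !mxE eqxx /=.
  by rewrite [RHS]mulrC.
move=> eqMN; apply/ffunP => c; apply/matrixP => y j.
by rewrite -!entry eqMN.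
Qed.

(** Only the intermediate label [one] survives, because [coev_mor f e] has no columns for any other
    [e]. *)
Lemma zigzag_term f a b c (x : 'I_(f b)) (y : 'I_(dual_obj f c))
    (l : 'I_(mult b c one)) (u : 'rV[k]_(f a)) :
  tens_row (tens_row (delta_mx 0 x : 'rV[k]_(f b)) (delta_mx 0 y : 'rV_(dual_obj f c)) l)
    u (idx1l a) *m assoc_mor f (dual_obj f) f a
    *m tens_mor (mxfam_id k f) (coev_mor f) a
  = \sum_(i < mult b one a) \sum_(j < mult c a one)
      Fmat (row_ix l (idx1l a)) (col_ix i j) *:
      tens_row (delta_mx 0 x : 'rV[k]_(f b))
        (tens_row (delta_mx 0 y : 'rV_(dual_obj f c)) u j *m coev_mor f one) i.
Proof.
rewrite tens_row_assoc mulmx_suml_scale sum_tagged.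
rewrite (bigD1 one) //= [X in _ + X]big1 ?addr0 => [|e ne]; last first.
  rewrite big1 // => -[i j] _ /=; rewrite tens_row_mor.
  suff -> : tens_row (delta_mx 0 y : 'rV_(dual_obj f c)) u j *m coev_mor f e = 0.
    by rewrite tens_row0r scaler0.
  by apply/rowP => r; rewrite (simple_ix_eq r) eqxx in ne.
rewrite sum_pair; apply: eq_bigr => i _; apply: eq_bigr => j _ /=.
by rewrite tens_row_mor mxfam_idE mulmx1.
Qed.

(** In degree [a] only the pairing of [a] with [dual a] survives. It selects the entry
    [dual_scalar a] of [F], which cancels the inverse scalar in [coev_mor]; this is the origin of
    the factor 1/u_a in the coevaluation. *)
Lemma system_zigzag f :
  mxfam_comp (mxfam_comp (mxfam_comp (lunit_mor f)
    (tens_mor (ev_mor f) (mxfam_id k f))) (assoc_mor f (dual_obj f) f))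
    (tens_mor (mxfam_id k f) (coev_mor f)) = runit_mor f.
Proof.
apply/ffunP => a; rewrite !mxfam_compE.
apply/row_matrixP => i; rewrite !rowE; move: (delta_mx 0 i) => u {i}.
rewrite !mulmxA row_lunit row_runit tens_row_mor mxfam_idE mulmx1 ev_row.
rewrite tens_row_bigl !mulmx_suml (bigD1 a) //= [X in _ + X]big1 ?addr0; last first.
  move=> b ba; rewrite tens_row_bigl !mulmx_suml big1 // => c _.
  rewrite tens_row_bigl !mulmx_suml big1 // => x _.
  rewrite tens_row_bigl !mulmx_suml big1 // => y _.
  rewrite tens_row_bigl !mulmx_suml big1 // => l _.
  rewrite zigzag_term big1 // => i _; rewrite big1 // => j _.
  by rewrite (idx_dualr_eq j) (idx_dualr_eq l) dualK eqxx in ba.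
rewrite tens_row_bigl !mulmx_suml (bigD1 (dual a)) //= [X in _ + X]big1 ?addr0; last first.
  move=> c ca; rewrite tens_row_bigl !mulmx_suml big1 // => x _.
  rewrite tens_row_bigl !mulmx_suml big1 // => y _.
  rewrite tens_row_bigl !mulmx_suml big1 // => l _.
  by rewrite (idx_dualr_eq l) eqxx in ca.
rewrite [in RHS](row_sum_delta u) tens_row_suml.
rewrite tens_row_bigl !mulmx_suml; apply: eq_bigr => x _.
(* [y] is the copy [x] itself, seen in [dual_obj f (dual a)] through [dualK]. *)
have [y xy] : {y : 'I_(dual_obj f (dual a)) | x = y :> nat}.
  by exists (cast_ord (congr1 f (esym (dualK a))) x).
rewrite (big_pred1 y) => [|z]; last by rewrite /= -val_eqE /= -xy eq_sym.
rewrite tens_row_bigl !mulmx_suml (bigD1 (idx_dualr a)) //=.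
rewrite [X in _ + X]big1 ?addr0 => [|l]; last first.
  by rewrite (index1_unique (mult_dualr a) l) eqxx.
rewrite zigzag_term (bigD1 (idx1r a)) //= [X in _ + X]big1 ?addr0 => [|l]; last first.
  by rewrite (index1_unique (mult1r_diag a) l) eqxx.
rewrite (bigD1 (idx_duall a)) //= [X in _ + X]big1 ?addr0 => [|l]; last first.
  by rewrite (index1_unique (mult_duall a) l) eqxx.
rewrite (coev_row _ xy) -[_ *: simple_row _]addr0 tens_rowPr tens_row0r addr0.
by rewrite scalerA mulrCA divff ?mulr1 // Fmat_dual.
Qed.

Lemma system_right_dual f : @is_right_dual k C f (dual_obj f) (coev_mor f) (ev_mor f).
Proof.
have [Ccat _] := system_category_ax S; have Cmon := system_monoidal S.
split; first exact: system_zigzag.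
have [ai aiP] := assoc_iso Cmon (dual_obj f : C) f (dual_obj f).
exists ai => //.
by apply: ev_nondegenerate; exact: (zigzag_transpose Ccat Cmon (system_zigzag f) aiP).
Qed.

(** The right dual of [dual_obj f] is [dual_obj (dual_obj f)], which is [f] by extensionality, so
    [dual_obj f] is also a left dual of [f]. The morphisms are quantified before rewriting because
    their types mention the double dual. *)
Lemma system_rigid : is_rigid C.
Proof.
split=> f.
  by exists (dual_obj f), (coev_mor f), (ev_mor f); exact: system_right_dual.
have fE : dual_obj (dual_obj f) = f.
  by apply: functional_extensionality => a; rewrite /dual_obj dualK.
exists (dual_obj f).
suff: exists coev ev, @is_right_dual k C (dual_obj f) (dual_obj (dual_obj f)) coev ev.
  by rewrite fE.
by exists (coev_mor (dual_obj f)), (ev_mor (dual_obj f)); exact: system_right_dual.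
Qed.

End Duals.

(** * Linear categories *)

Section LinearCategory.
Variables (k : fieldType) (C : moncat_data k).
Hypotheses (Ccat : is_category C) (Clin : is_linear_category C).
Implicit Types x y z w : C.
Let compA x y z w := @compmA k C Ccat x y z w.
Let compI1 x y := @comp1m k C Ccat x y.
Let comp1I x y := @compm1 k C Ccat x y.

Lemma comp_linr x y z (g : hom y z) (c : k) (f f' : hom x y) :
  g \oc (c *: f + f') = c *: (g \oc f) + (g \oc f').
Proof. by case: Clin. Qed.

Lemma comp_linl x y z (f : hom x y) (c : k) (g g' : hom y z) :
  (c *: g + g') \oc f = c *: (g \oc f) + (g' \oc f).
Proof. by case: Clin. Qed.

Lemma comp0r x y z (g : hom y z) : g \oc (0 : hom x y) = 0.
Proof.
by have := comp_linr g (-1) (0 : hom x y) 0; rewrite scaler0 addr0 scaleN1r addNr.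
Qed.

Lemma comp0l x y z (f : hom x y) : (0 : hom y z) \oc f = 0.
Proof.
by have := comp_linl f (-1) (0 : hom y z) 0; rewrite scaler0 addr0 scaleN1r addNr.
Qed.

Lemma compDr x y z (g : hom y z) (f f' : hom x y) :
  g \oc (f + f') = (g \oc f) + (g \oc f').
Proof. by rewrite -[f in LHS]scale1r comp_linr scale1r. Qed.

Lemma compDl x y z (f : hom x y) (g g' : hom y z) :
  (g + g') \oc f = (g \oc f) + (g' \oc f).
Proof. by rewrite -[g in LHS]scale1r comp_linl scale1r. Qed.

Lemma compZr x y z (g : hom y z) c (f : hom x y) : g \oc (c *: f) = c *: (g \oc f).
Proof. by rewrite -[c *: f]addr0 comp_linr comp0r addr0. Qed.

Lemma compZl x y z (f : hom x y) c (g : hom y z) : (c *: g) \oc f = c *: (g \oc f).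
Proof. by rewrite -[c *: g]addr0 comp_linl comp0l addr0. Qed.

Lemma compBr x y z (g : hom y z) (f f' : hom x y) :
  g \oc (f - f') = (g \oc f) - (g \oc f').
Proof. by rewrite compDr -[- f']scaleN1r compZr scaleN1r. Qed.

Lemma compBl x y z (f : hom x y) (g g' : hom y z) :
  (g - g') \oc f = (g \oc f) - (g' \oc f).
Proof. by rewrite compDl -[- g']scaleN1r compZl scaleN1r. Qed.

Lemma comp_sumr x y z (g : hom y z) (I : Type) (r : seq I) P (F : I -> hom x y) :
  g \oc (\sum_(i <- r | P i) F i) = \sum_(i <- r | P i) (g \oc F i).
Proof. exact: (big_morph (fun f => g \oc f) (compDr g) (comp0r _ g)). Qed.

Lemma comp_suml x y z (f : hom x y) (I : Type) (r : seq I) P (F : I -> hom y z) :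
  (\sum_(i <- r | P i) F i) \oc f = \sum_(i <- r | P i) (F i \oc f).
Proof. exact: (big_morph (fun g => g \oc f) (compDl f) (comp0l _ f)). Qed.

Lemma split_mono x y (i : hom x y) (r : hom y x) : r \oc i = idm x -> is_mono i.
Proof.
move=> ri z g h /(congr1 (fun f => r \oc f)).
by rewrite !compA ?ri ?compI1.
Qed.

(** The complementary idempotent kills exactly the morphisms that factor through [i]. As
    monomorphisms and epimorphisms of matrix families split, this and its dual give the last two
    axioms of an abelian category. *)
Lemma split_mono_kernel x y (i : hom x y) (r : hom y x) :
  r \oc i = idm x -> is_kernel (idm y - (i \oc r)) i.
Proof.
move=> ri; split; first by rewrite compBl compI1 -compA ri comp1I subrr.
move=> w g; rewrite compBl compI1 => /eqP; rewrite subr_eq0 => /eqP gE.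
exists (r \oc g); split; first by rewrite compA.
by move=> h' <-; rewrite compA ri compI1.
Qed.

Lemma split_epi_cokernel x y (p : hom y x) (s : hom x y) :
  p \oc s = idm x -> is_cokernel (idm y - (s \oc p)) p.
Proof.
move=> ps; split; first by rewrite compBr comp1I compA ps compI1 subrr.
move=> w g; rewrite compBr comp1I => /eqP; rewrite subr_eq0 => /eqP gE.
exists (g \oc s); split; first by rewrite -compA.
by move=> h' <-; rewrite -compA ps comp1I.
Qed.

Lemma isomorphic_sym x y : isomorphic x y -> isomorphic y x.
Proof. by case=> f [g fg]; exists g, f; exact: inverse_sym. Qed.

Definition scalar_endomorphisms x := bijective (fun c : k => c *: idm x).

Lemma isomorphic_scalar x y :
  isomorphic x y -> scalar_endomorphisms y -> scalar_endomorphisms x.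
Proof.
case=> u [v [vu uv]] [h hK Kh].
exists (fun f => h (u \oc f \oc v)) => [c|f].
  by rewrite compZr comp1I compZl uv hK.
have := Kh (u \oc f \oc v) => /(congr1 (fun q => v \oc q \oc u)).
rewrite compZr comp1I compZl vu; move: (h _) => c.
by rewrite !compA vu compI1 -compA vu comp1I.
Qed.

Section FiniteDirectSums.
Variables (T : finType) (s : T -> C) (x : C).

Definition biproduct (i : forall t, hom (s t) x) (p : forall t, hom x (s t)) :=
  [/\ forall t, p t \oc i t = idm (s t),
      forall t u, t != u -> p t \oc i u = 0
    & \sum_t (i t \oc p t) = idm x].

Lemma biproduct_direct_sum i p :
  biproduct i p -> is_direct_sum (fun j : 'I_#|T| => s (enum_val j)) x.
Proof.
case=> pi pi0 ip; exists (fun j => i (enum_val j)), (fun j => p (enum_val j)).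
split=> // [j l jl|]; first by rewrite pi0 // (can_eq enum_valK).
by rewrite -(big_enum_val (fun t => i t \oc p t)) ip.
Qed.

Lemma direct_sum_biproduct :
  is_direct_sum (fun j : 'I_#|T| => s (enum_val j)) x ->
  exists i p, biproduct i p.
Proof.
case=> i [p [pi pi0 ip]].
(* [enum_val (enum_rank t)] equals [t] only propositionally, so the given morphisms are transported
   along [enum_rankK]. *)
pose ci t j (e : enum_val j = t) : hom (s t) x :=
  match e in _ = t' return hom (s t') x with erefl => i j end.
pose cp t j (e : enum_val j = t) : hom x (s t) :=
  match e in _ = t' return hom x (s t') with erefl => p j end.
exists (fun t => ci _ _ (enum_rankK t)), (fun t => cp _ _ (enum_rankK t)); split.
- by move=> t; move: (enum_rankK t); move: (enum_rank t) => j e; case: _ / e => /=.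
- move=> t u tu.
  have : enum_rank t != enum_rank u by rewrite (can_eq enum_rankK).
  move: (enum_rankK t) (enum_rankK u).
  move: (enum_rank t) (enum_rank u) => j l e e' jl.
  by case: _ / e; case: _ / e' => /=; exact: pi0.
rewrite -ip (big_enum_val (fun t => ci _ _ (enum_rankK t) \oc cp _ _ (enum_rankK t))).
apply: eq_bigr => j _.
suff cE l (e : enum_val l = enum_val j) : ci _ l e \oc cp _ l e = i j \oc p j by [].
have lj : l = j by exact: (can_inj enum_valK).
by case: _ / lj e => e; rewrite (eq_axiomK e).
Qed.

End FiniteDirectSums.
End LinearCategory.

(** * The matrix category is a fusion category *)

Section Abelian.
Variables (k : fieldType) (S : fusion_system k).
Implicit Types (a b c d e : S) (f g h : S -> nat).
Local Notation C := (system_category S).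

(** Transposition is a contravariant involution of the matrix category; kernels and splittings of
    monomorphisms are deduced through it from the dual statements. *)
Definition trfam f g (A : mxfam k f g) : mxfam k g f := [ffun a => (A a)^T].

Lemma trfamE f g (A : mxfam k f g) a : trfam A a = (A a)^T.
Proof. by rewrite ffunE. Qed.

Lemma trfamK f g : cancel (@trfam f g) (@trfam g f).
Proof. by move=> A; apply/ffunP => a; rewrite !trfamE trmxK. Qed.

Lemma trfam_comp f g h (B : mxfam k g h) (A : mxfam k f g) :
  trfam (mxfam_comp B A) = mxfam_comp (trfam A) (trfam B).
Proof. by apply/ffunP => a; rewrite trfamE !mxfam_compE !trfamE trmx_mul. Qed.

Lemma trfam_id f : trfam (mxfam_id k f) = mxfam_id k f.
Proof. by apply/ffunP => a; rewrite trfamE mxfam_idE trmx1. Qed.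

Lemma trfam0 f g : trfam (0 : mxfam k f g) = 0.
Proof. by apply/ffunP => a; rewrite trfamE !mxfam0E trmx0. Qed.

(** A product [B a *m A a] vanishes exactly when the rows of [B a] lie in the left kernel of [A a].
    With a basis of this kernel as the rows of [P a], the factorization exists by inclusion of row
    spaces and is unique because [P a] is row free. *)
Lemma mxfam_cokernel f g (A : mxfam k f g) :
  exists z (P : mxfam k g z), mxfam_comp P A = 0 /\
    forall h (B : mxfam k g h), mxfam_comp B A = 0 ->
      exists! D : mxfam k z h, mxfam_comp D P = B.
Proof.
pose z a := \rank (kermx (A a)).
pose P : mxfam k g z := [ffun a => row_base (kermx (A a))].
have PE a : P a = row_base (kermx (A a)) by rewrite /P ffunE.
exists z, P; split.
  apply/ffunP => a; rewrite mxfam_compE mxfam0E PE.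
  by apply/sub_kermxP; rewrite eq_row_base.
move=> h B BA.
exists [ffun a => B a *m pinvmx (P a)]; split.
  apply/ffunP => a; rewrite mxfam_compE ffunE mulmxKpV // PE eq_row_base.
  by apply/sub_kermxP; rewrite -mxfam_compE BA mxfam0E.
move=> D DP; apply/ffunP => a; rewrite ffunE -DP mxfam_compE.
by rewrite -mulmxA mulmxVp ?mulmx1 // PE row_base_free.
Qed.

Lemma mxfam_kernel f g (A : mxfam k f g) :
  exists z (P : mxfam k z f), mxfam_comp A P = 0 /\
    forall h (B : mxfam k h f), mxfam_comp A B = 0 ->
      exists! D : mxfam k h z, mxfam_comp P D = B.
Proof.
have [z [P [PA Puniv]]] := mxfam_cokernel (trfam A).
exists z, (trfam P); split.
  by rewrite -[A]trfamK -trfam_comp PA trfam0.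
move=> h B AB; have [|D [DP Duniq]] := Puniv h (trfam B).
  by rewrite -trfam_comp AB trfam0.
exists (trfam D); split; first by rewrite -trfam_comp DP trfamK.
move=> D' PD'; rewrite (Duniq (trfam D')) ?trfamK //.
by rewrite -PD' trfam_comp trfamK.
Qed.

Lemma mxfam_epi_split f g (P : mxfam k f g) :
  (forall h (B D : mxfam k g h), mxfam_comp B P = mxfam_comp D P -> B = D) ->
  exists M, mxfam_comp P M = mxfam_id k g.
Proof.
move=> Pepi; exists [ffun a => pinvmx (P a)]; apply/ffunP => a.
rewrite mxfam_compE ffunE mxfam_idE mulmxVp // -kermx_eq0.
(* The family of left kernels has the same composite with [P] as the zero family, so it vanishes and
   every [P a] is row free. *)
have /ffunP/(_ a): [ffun a => kermx (P a)] = 0 :> mxfam k g g.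
  apply: Pepi; apply/ffunP => b.
  by rewrite !mxfam_compE ffunE mulmx_ker mxfam0E mul0mx.
by rewrite mxfam0E ffunE => ->.
Qed.

Lemma mxfam_mono_split f g (M : mxfam k f g) :
  (forall h (B D : mxfam k h f), mxfam_comp M B = mxfam_comp M D -> B = D) ->
  exists P, mxfam_comp P M = mxfam_id k f.
Proof.
move=> Mmono; have [|P MP] := @mxfam_epi_split _ _ (trfam M).
  move=> h B D eqBD; apply: (can_inj (@trfamK f h)); apply: Mmono.
  by rewrite -[M]trfamK -!trfam_comp eqBD.
by exists (trfam P); rewrite -[M]trfamK -trfam_comp MP trfam_id.
Qed.

Lemma sum_delta_mul (T : finType) (u v : T) :
  \sum_t (u == t)%:R * (v == t)%:R = (u == v)%:R :> k.
Proof.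
rewrite (bigD1 u) //= eqxx mul1r [v == u]eq_sym big1 ?addr0 // => t /negPf ne.
by rewrite [u == t]eq_sym ne mul0r.
Qed.

Section DirectSums.
Variables (n : nat) (s : 'I_n -> S -> nat).

Let copies a : finType := {j : 'I_n & 'I_(s j a)}.
Let total a := #|copies a|.
Let inj j : mxfam k (s j) total :=
  [ffun a => \matrix_(r, y) ((enum_val r : copies a) == existT _ j y)%:R].

Lemma system_direct_sum : exists x : C, is_direct_sum (s : 'I_n -> C) x.
Proof.
exists total, inj, (fun j => trfam (inj j)); split.
- move=> j; apply/ffunP => a; rewrite mxfam_compE trfamE mxfam_idE ffunE.
  apply/matrixP => y y'; rewrite !mxE.
  under eq_bigr => r _ do rewrite !mxE ![enum_val r == _]eq_sym.
  by rewrite -(big_enum_val (fun t : copies a =>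
       (existT _ j y == t)%:R * (existT _ j y' == t)%:R)) sum_delta_mul eq_Tagged.
- move=> j l jl; apply/ffunP => a; rewrite mxfam_compE trfamE mxfam0E !ffunE.
  apply/matrixP => y y'; rewrite !mxE.
  rewrite big1 // => r _; rewrite !mxE.
  case: eqP => [->|_]; last by rewrite mul0r.
  case: eqP => [[jl']|_]; last by rewrite mulr0.
  by rewrite jl' eqxx in jl.
apply/ffunP => a; rewrite mxfam_sumE mxfam_idE.
apply/matrixP => r r'; rewrite summxE mxE.
rewrite -(can_eq enum_valK) -sum_delta_mul sum_tagged.
apply: eq_bigr => j _; rewrite mxfam_compE trfamE !ffunE mxE.
by apply: eq_bigr => y _; rewrite !mxE.
Qed.

End DirectSums.

Lemma system_abelian : is_abelian C.
Proof.
have [Ccat Clin] := system_category_ax S.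
split.
- exact: system_direct_sum.
- move=> f g A; have [z [P [AP Puniv]]] := mxfam_kernel A.
  by exists z, P; split.
- move=> f g A; have [z [P [PA Puniv]]] := mxfam_cokernel A.
  by exists z, P; split.
- move=> f g M Mmono; have [P PM] := mxfam_mono_split Mmono.
  by exists g, (idm g - (M \oc (P : hom (g : C) f))); exact: split_mono_kernel.
move=> f g P Pepi; have [M PM] := mxfam_epi_split Pepi.
by exists f, (idm f - ((M : hom (g : C) f) \oc P)); exact: split_epi_cokernel.
Qed.

Lemma simple_obj_id_neq0 a : mxfam_id k (simple_obj a) <> 0.
Proof.
move/ffunP/(_ a)/matrixP/(_ (simple_ix a) (simple_ix a)).
by rewrite mxfam_idE mxfam0E !mxE eqxx => /eqP; rewrite oner_eq0.
Qed.

Lemma simple_obj_scalar a : scalar_endomorphisms (simple_obj a : C).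
Proof.
exists (fun A : mxfam k (simple_obj a) (simple_obj a) => A a (simple_ix a) (simple_ix a)).
  move=> c; rewrite -[c *: _]addr0 mxfam_linE mxfam0E mxfam_idE !mxE eqxx.
  by rewrite addr0 mulr1.
move=> A; apply/ffunP => b; apply/matrixP => r r'.
rewrite -[_ *: _ in LHS]addr0 mxfam_linE mxfam0E mxfam_idE !mxE addr0.
case: (simple_ixP r) r' A => r' A; rewrite (index1_unique (simple_obj_diag a) r').
by rewrite eqxx mulr1.
Qed.

(** A monomorphism [M] into the object splits by some [P], and the idempotent [M \oc P] is a scalar
    [c] with [c * c = c]. If [c = 0] then [M] vanishes, and if [c = 1] it is invertible. *)
Lemma simple_obj_simple a : is_simple (simple_obj a : C).
Proof.
have [Ccat Clin] := system_category_ax S.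
split; first exact: simple_obj_id_neq0.
move=> g M Mmono; have [P PM] := mxfam_mono_split Mmono.
have {}PM : (P : hom (simple_obj a : C) g) \oc M = idm g by [].
have [coef coefI coefK] := simple_obj_scalar a.
move: (coefK (M \oc P)); move: (coef _) => c cE.
have [c0|c0] := eqVneq c 0.
  left; rewrite -[M](compm1 Ccat) -PM (compmA Ccat) -cE c0 scale0r.
  exact: comp0l.
right; exists P; split=> //.
have : (M \oc P) \oc (M \oc P) = M \oc P.
  by rewrite -(compmA Ccat) (compmA Ccat P) PM (comp1m Ccat).
rewrite -cE (compZl Clin) (comp1m Ccat) scalerA => /(can_inj coefI).
by rewrite -[RHS]mulr1 => /(mulfI c0) ->; rewrite scale1r.
Qed.

Section Semisimple.
Variable f : S -> nat.
Let summand : finType := {a & 'I_(f a)}.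
Let inj (t : summand) : mxfam k (simple_obj (tag t)) f :=
  [ffun b => \matrix_(y, _) (t == existT _ b y)%:R].

Lemma system_biproduct :
  @biproduct k C summand (fun t => simple_obj (tag t)) f
    inj (fun t => trfam (inj t)).
Proof.
split.
- move=> t; apply/ffunP => b; rewrite mxfam_compE trfamE mxfam_idE ffunE.
  apply/matrixP => r r'; rewrite !mxE.
  have tb := simple_ix_eq r.
  under eq_bigr => y _ do rewrite !mxE.
  case: t r r' tb => a x /= r r' ab.
  case: _ / ab r r' => r r'; rewrite (bigD1 x) //= eqxx mulr1 big1 ?addr0.
    rewrite (index1_unique (simple_obj_diag a) r).
    by rewrite (index1_unique (simple_obj_diag a) r') eqxx.
  by move=> y /negPf ne; rewrite eq_Tagged /= eq_sym ne mul0r.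
- move=> t u tu; apply/ffunP => b; rewrite mxfam_compE trfamE mxfam0E !ffunE.
  apply/matrixP => r r'; rewrite !mxE big1 // => y _; rewrite !mxE.
  case: eqP => [te|_]; last by rewrite mul0r.
  by rewrite -te eq_sym (negPf tu) mulr0.
apply/ffunP => b; rewrite mxfam_sumE mxfam_idE.
apply/matrixP => y y'; rewrite summxE mxE.
rewrite (bigD1 (existT _ b y : summand)) //= [X in _ + X]big1 ?addr0.
  rewrite mxfam_compE trfamE ffunE mxE.
  rewrite (bigD1 (simple_ix b)) //= [X in _ + X]big1 ?addr0 => [|r].
    by rewrite !mxE eqxx mul1r eq_Tagged.
  by rewrite (index1_unique (simple_obj_diag b) r) eqxx.
move=> t /negPf ne; rewrite mxfam_compE trfamE ffunE mxE big1 // => r _.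
by rewrite !mxE ne mul0r.
Qed.

End Semisimple.

Lemma system_semisimple : is_semisimple C.
Proof.
move=> f; exists #|{a : S & 'I_(f a)} : finType|,
  (fun j => simple_obj (tag (enum_val j))); split.
  by move=> j; exact: simple_obj_simple.
exact: (biproduct_direct_sum (system_biproduct f)).
Qed.

(** The identity of a simple object is nonzero, so its decomposition has a summand, whose inclusion
    is a nonzero split monomorphism and hence invertible. *)
Lemma system_simple_iso f :
  is_simple (f : C) -> exists a, isomorphic (f : C) (simple_obj a).
Proof.
have [Ccat Clin] := system_category_ax S.
case=> id0 fmono; have [pi _ ip] := system_biproduct f.
have [t _|none] := pickP (predT : pred {a & 'I_(f a)}); last first.
  by case: id0; rewrite -ip big1 // => t; have := none t.
exists (tag t); apply: isomorphic_sym.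
have [i0|iso] := fmono _ _ (split_mono Ccat (pi t)); last by eexists; exact: iso.
by case: (@simple_obj_id_neq0 (tag t)); rewrite -[LHS](pi t) i0 comp0r.
Qed.

Lemma system_fusion_category : is_fusion_category C.
Proof.
split.
- exact: system_category_ax.
- split; [exact: system_abelian | exact: system_semisimple].
- split; [exact: system_monoidal|exact: system_tensor_bilinear|exact: system_rigid].
- split; last exact: simple_obj_simple.
  exists #|S|, (fun j => simple_obj (enum_val j)) => f /system_simple_iso[a fa].
  by exists (enum_rank a); rewrite enum_rankK.
move=> f /system_simple_iso[a fa].
have [Ccat Clin] := system_category_ax S.
exact: (isomorphic_scalar Ccat Clin fa (simple_obj_scalar a)).
Qed.

End Abelian.

Arguments fmap {k C D} l {x y}.

(** * Reconstruction from an extracted system *)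

Section EquivalenceCriterion.
Variables (k : fieldType) (C D : moncat_data k) (F : linear_functor C D).
Hypotheses (Dcat : is_category D) (Dlin : is_linear_category D).
Hypothesis Ffaithful : forall x y (f g : hom x y), fmap F f = fmap F g -> f = g.
Hypothesis Ffull : forall x y (g : hom (F x) (F y)), exists f, fmap F f = g.
Hypothesis Fsurj : forall y : D, exists x : C, isomorphic (F x) y.

Let preimage x y (g : hom (F x) (F y)) : hom x y :=
  proj1_sig (constructive_indefinite_description _ (Ffull g)).

Let preimageK x y (g : hom (F x) (F y)) : fmap F (preimage g) = g.
Proof. by rewrite /preimage; case: constructive_indefinite_description. Qed.

Let G (y : D) : C := proj1_sig (constructive_indefinite_description _ (Fsurj y)).

Let counit_ex y : exists f : hom (F (G y)) y, is_iso f.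
Proof. by rewrite /G; case: constructive_indefinite_description. Qed.

Let eps y : hom (F (G y)) y :=
  proj1_sig (constructive_indefinite_description _ (counit_ex y)).

Let eps_iso y : is_iso (eps y).
Proof. by rewrite /eps; case: constructive_indefinite_description. Qed.

Let eps' y : hom y (F (G y)) :=
  proj1_sig (constructive_indefinite_description _ (eps_iso y)).

Let epsK y : inverse_pair (eps y) (eps' y).
Proof. by rewrite /eps'; case: constructive_indefinite_description. Qed.

(** Preimages under [fmap F] are chosen, but unique by faithfulness. Hence linearity and
    functoriality can be checked after applying [F], where the map is conjugation by the counit
    [eps]. *)
Definition quasi_inverse_map y y' (g : hom y y') : hom (G y) (G y') :=
  preimage (eps' y' \oc g \oc eps y).

Fact quasi_inverse_map_linear y y' : linear (@quasi_inverse_map y y').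
Proof.
move=> c f g; apply: Ffaithful; rewrite linearP !preimageK.
by rewrite (comp_linr Dlin) (comp_linl Dlin).
Qed.

HB.instance Definition _ y y' :=
  GRing.isLinear.Build k (hom y y') (hom (G y) (G y')) *:%R
    (@quasi_inverse_map y y') (quasi_inverse_map_linear (y' := y')).

Fact quasi_inverse_id y : quasi_inverse_map (idm y) = idm (G y).
Proof.
apply: Ffaithful; rewrite preimageK fmap_id (compm1 Dcat).
by case: (epsK y).
Qed.

Fact quasi_inverse_comp x y z (g : hom y z) (f : hom x y) :
  quasi_inverse_map (g \oc f) = quasi_inverse_map g \oc quasi_inverse_map f.
Proof.
apply: Ffaithful; rewrite fmap_comp !preimageK !(compmA Dcat).
rewrite -[X in _ = X \oc _ \oc _](compmA Dcat); case: (epsK y) => _ ->.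
by rewrite (compm1 Dcat).
Qed.

Lemma fully_faithful_equivalence : is_equivalence F.
Proof.
pose Ginv := @LinearFunctor k D C G (fun y y' => @quasi_inverse_map y y')
  quasi_inverse_id quasi_inverse_comp.
have FG y y' (g : hom y y') : fmap F (fmap Ginv g) = eps' y' \oc g \oc eps y.
  exact: preimageK.
exists Ginv, (fun x => preimage (eps' (F x))), eps; split.
- move=> x; exists (preimage (eps (F x))); case: (epsK (F x)) => ee' e'e.
  by split; apply: Ffaithful; rewrite fmap_comp fmap_id !preimageK.
- move=> x x' f; apply: Ffaithful; rewrite !fmap_comp FG !preimageK.
  by rewrite -!(compmA Dcat); case: (epsK (F x)) => _ ->; rewrite (compm1 Dcat).
- exact: eps_iso.
move=> y y' g; rewrite FG !(compmA Dcat); case: (epsK y') => _ ->.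
by rewrite (comp1m Dcat).
Qed.

End EquivalenceCriterion.

Section Schur.
Variables (k : fieldType) (C : moncat_data k).
Hypotheses (Ccat : is_category C) (Clin : is_linear_category C).
Hypothesis Cab : is_abelian C.
Implicit Types x y z : C.

(** The kernel of [f] is a monomorphism into the simple object [x]. If it is invertible then
    [f = 0]; if it is zero then [f] is a monomorphism into the simple object [y]. *)
Lemma schur x y (f : hom x y) :
  is_simple x -> is_simple y -> f = 0 \/ is_iso f.
Proof.
move=> [_ xsimple] [_ ysimple].
have [_ ker _ _ _] := Cab.
have [z [i [fi iuniv]]] := ker _ _ f.
have imono : is_mono i.
  move=> w g h eqgh; have [|l [_ luniq]] := iuniv w (i \oc g).
    by rewrite (compmA Ccat) fi (comp0l Clin).
  by rewrite -(luniq g) // -(luniq h).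
have [i0|[j [_ ij]]] := xsimple _ _ imono; last first.
  by left; rewrite -[f](compm1 Ccat) -ij (compmA Ccat) fi (comp0l Clin).
apply: ysimple => w g h /eqP; rewrite -subr_eq0 -(compBr Clin) => /eqP/iuniv[l [il _]].
by apply/eqP; rewrite -subr_eq0 -il i0 (comp0l Clin).
Qed.

End Schur.

Section TensorBilinear.
Variables (k : fieldType) (C : moncat_data k).
Hypothesis Cbil : is_tensor_bilinear C.
Implicit Types x y : C.

Lemma tensm0l x x' y y' (g : hom y y') : (0 : hom x x') \om g = 0.
Proof.
have [_ linl] := Cbil.
by have := linl _ _ _ _ g (-1) (0 : hom x x') 0; rewrite scaler0 addr0 scaleN1r addNr.
Qed.

Lemma tensm0r x x' y y' (f : hom x x') : f \om (0 : hom y y') = 0.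
Proof.
have [linr _] := Cbil.
by have := linr _ _ _ _ f (-1) (0 : hom y y') 0; rewrite scaler0 addr0 scaleN1r addNr.
Qed.

Lemma tensmZl x x' y y' (g : hom y y') (c : k) (f : hom x x') :
  (c *: f) \om g = c *: (f \om g).
Proof. by have [_ linl] := Cbil; rewrite -[c *: f]addr0 linl tensm0l addr0. Qed.

Lemma tensmZr x x' y y' (f : hom x x') (c : k) (g : hom y y') :
  f \om (c *: g) = c *: (f \om g).
Proof. by have [linr _] := Cbil; rewrite -[c *: g]addr0 linr tensm0r addr0. Qed.

Lemma tensm_suml x x' y y' (g : hom y y') (I : finType) (F : I -> hom x x') :
  (\sum_i F i) \om g = \sum_i (F i \om g).
Proof.
have [_ linl] := Cbil.
apply: (big_morph (fun f => f \om g)); last exact: tensm0l.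
by move=> f f'; rewrite -[f in LHS]scale1r linl scale1r.
Qed.

Lemma tensm_sumr x x' y y' (f : hom x x') (I : finType) (G : I -> hom y y') :
  f \om (\sum_i G i) = \sum_i (f \om G i).
Proof.
have [linr _] := Cbil.
apply: (big_morph (fun g => f \om g)); last exact: tensm0r.
by move=> g g'; rewrite -[g in LHS]scale1r linr scale1r.
Qed.

End TensorBilinear.

Lemma hom_of_eqK (k : fieldType) (C : moncat_data k) (Ccat : is_category C)
    (x y : C) (e : x = y) : inverse_pair (hom_of_eq e) (hom_of_eq (esym e)).
Proof. by case: _ / e; split; rewrite comp1m. Qed.

Section ExtractedEquivalence.
Variables (k : fieldType) (S : fusion_system k) (C : moncat_data k).
Hypothesis Cfus : is_fusion_category C.
Implicit Types (a b c d e : S) (f g h : S -> nat) (X Y Z : C).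

Let Ccat : is_category C. Proof. by case: Cfus => -[]. Qed.
Let Clin : is_linear_category C. Proof. by case: Cfus => -[]. Qed.
Let Cab : is_abelian C. Proof. by case: Cfus => _ []. Qed.
Let Css : is_semisimple C. Proof. by case: Cfus => _ []. Qed.
Let Cmon : is_monoidal C. Proof. by case: Cfus => _ _ []. Qed.
Let Cbil : is_tensor_bilinear C. Proof. by case: Cfus => _ _ []. Qed.
Let Cend (x : C) : is_simple x -> scalar_endomorphisms x.
Proof. by case: Cfus => _ _ _ _; apply. Qed.

Let compA x y z w := @compmA k C Ccat x y z w.
Let compI1 x y := @comp1m k C Ccat x y.
Let comp1I x y := @compm1 k C Ccat x y.

(** * Direct sums of representatives and the underlying functor *)

Variables (rep : S -> C).
Hypothesis rep_simple : forall a, is_simple (rep a).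
Hypothesis rep_inj : forall a b, isomorphic (rep a) (rep b) -> a = b.
Hypothesis rep_surj : forall x : C, is_simple x -> exists a, isomorphic x (rep a).

Lemma hom_rep_neq a b (f : hom (rep a) (rep b)) : a != b -> f = 0.
Proof.
have [//|fiso] := schur Ccat Clin Cab f (rep_simple a) (rep_simple b).
by case/eqP; apply: rep_inj; exists f.
Qed.

Lemma end_rep_scalar a (f : hom (rep a) (rep a)) : exists c : k, f = c *: idm (rep a).
Proof. by have [h _ hK] := Cend (rep_simple a); exists (h f). Qed.

Lemma scale_rep_inj a : injective (fun c : k => c *: idm (rep a)).
Proof. exact: bij_inj (Cend (rep_simple a)). Qed.

(** Of the direct sum only the resolution of the identity is kept, which suffices to test morphisms
    on the representatives. *)
Lemma rep_decomposition X : exists n (c : 'I_n -> S)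
    (i : forall j, hom (rep (c j)) X) (p : forall j, hom X (rep (c j))),
  \sum_j (i j \oc p j) = idm X.
Proof.
have [n [s [ssimple [i [p [_ _ ip]]]]]] := Css X.
have /fin_all_exists[c cP] j := rep_surj (ssimple j).
have /fin_all_exists[u uP] j : exists u : hom (s j) (rep (c j)), is_iso u := cP j.
have /fin_all_exists[v vP] j : exists v, inverse_pair (u j) v := uP j.
exists n, c, (fun j => i j \oc v j), (fun j => u j \oc p j).
rewrite -ip; apply: eq_bigr => j _.
by rewrite compA -[i j \oc v j \oc u j]compA; case: (vP j) => -> _; rewrite comp1I.
Qed.

Lemma rep_jointly_faithful X Y (g h : hom X Y) :
  (forall a (q : hom Y (rep a)), q \oc g = q \oc h) -> g = h.
Proof.
move=> qgh; have [n [c [i [p ip]]]] := rep_decomposition Y.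
rewrite -[g]compI1 -[h]compI1 -ip !(comp_suml Clin).
by apply: eq_bigr => j _; rewrite -!compA qgh.
Qed.

(* Homs into the simple objects jointly detect isomorphisms, because every
   identity factors through them. *)
Lemma iso_of_bijective_rep X Y (phi : hom X Y) :
  (forall a (g h : hom Y (rep a)), g \oc phi = h \oc phi -> g = h) ->
  (forall a (q : hom X (rep a)), exists r, r \oc phi = q) -> is_iso phi.
Proof.
move=> phi_inj phi_surj; have [n [c [i [p ip]]]] := rep_decomposition X.
have /fin_all_exists[q qP] j := phi_surj _ (p j).
pose psi := \sum_j (i j \oc q j).
have psiK : psi \oc phi = idm X.
  by rewrite -ip (comp_suml Clin); apply: eq_bigr => j _; rewrite -compA qP.
exists psi; split=> //; apply: rep_jointly_faithful => a g.
by apply: phi_inj; rewrite !compA -[LHS]compA psiK !comp1I.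
Qed.

Lemma rep_sum_ex f : exists x,
  exists (i : forall t : {a & 'I_(f a)}, hom (rep (tag t)) x)
         (p : forall t : {a & 'I_(f a)}, hom x (rep (tag t))),
    biproduct i p.
Proof.
have [sum _ _ _ _] := Cab.
have [x xP] := sum _ (fun j : 'I_#|{a & 'I_(f a)} : finType| => rep (tag (enum_val j))).
by exists x; apply: (direct_sum_biproduct xP).
Qed.

(** Object, inclusions and projections are chosen in turn, since each existence statement depends on
    the preceding choice. *)
Definition rep_sum f : C :=
  proj1_sig (constructive_indefinite_description _ (rep_sum_ex f)).

Lemma rep_sum_biproduct f :
  exists i, exists p, @biproduct k C {a & 'I_(f a)} (fun t => rep (tag t)) (rep_sum f) i p.
Proof. by rewrite /rep_sum; case: constructive_indefinite_description. Qed.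

Definition inclusions f : forall t : {a & 'I_(f a)}, hom (rep (tag t)) (rep_sum f) :=
  proj1_sig (constructive_indefinite_description _ (rep_sum_biproduct f)).

Lemma inclusionsP f : exists p, biproduct (@inclusions f) p.
Proof. by rewrite /inclusions; case: constructive_indefinite_description. Qed.

Definition projections f : forall t : {a & 'I_(f a)}, hom (rep_sum f) (rep (tag t)) :=
  proj1_sig (constructive_indefinite_description _ (inclusionsP f)).

Lemma projectionsP f : biproduct (@inclusions f) (@projections f).
Proof. by rewrite /projections; case: constructive_indefinite_description. Qed.

Definition incl f a (x : 'I_(f a)) : hom (rep a) (rep_sum f) :=
  inclusions (existT _ a x).

Definition proj f a (x : 'I_(f a)) : hom (rep_sum f) (rep a) :=
  projections (existT _ a x).

Lemma projK f a (x : 'I_(f a)) : proj x \oc incl x = idm (rep a).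
Proof. by have [pi _ _] := projectionsP f; exact: (pi (existT _ a x)). Qed.

Lemma proj_incl f a (x y : 'I_(f a)) : y != x -> proj y \oc incl x = 0.
Proof.
have [_ pi0 _] := projectionsP f => ne; apply: (pi0 (existT _ a y) (existT _ a x)).
by rewrite eq_Tagged.
Qed.

Lemma incl_proj f : \sum_a \sum_(x < f a) (incl x \oc proj x) = idm (rep_sum f).
Proof. by have [_ _ <-] := projectionsP f; rewrite sum_tagged. Qed.

Definition row_hom f a (u : 'rV[k]_(f a)) : hom (rep_sum f) (rep a) :=
  \sum_x u 0 x *: proj x.

Lemma row_hom_delta f a (x : 'I_(f a)) :
  row_hom (delta_mx 0 x : 'rV_(f a)) = proj x.
Proof.
rewrite /row_hom (bigD1 x) //= big1 ?addr0 => [|y /negPf ne].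
  by rewrite mxE !eqxx scale1r.
by rewrite mxE ne andbF scale0r.
Qed.

Lemma row_hom_linear f a (c : k) (u v : 'rV_(f a)) :
  row_hom (c *: u + v) = c *: row_hom u + row_hom v.
Proof.
rewrite /row_hom scaler_sumr -big_split; apply: eq_bigr => x _ /=.
by rewrite !mxE scalerDl scalerA.
Qed.

HB.instance Definition _ f a :=
  GRing.isLinear.Build k 'rV[k]_(f a) (hom (rep_sum f) (rep a)) *:%R (@row_hom f a)
    (@row_hom_linear f a).

Lemma row_hom_incl f a (u : 'rV_(f a)) x :
  row_hom u \oc incl x = u 0 x *: idm (rep a).
Proof.
rewrite /row_hom (comp_suml Clin) (bigD1 x) //= (compZl Clin) projK big1 ?addr0 //.
by move=> y ne; rewrite (compZl Clin) proj_incl ?scaler0.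
Qed.

Lemma row_hom_inj f a : injective (@row_hom f a).
Proof.
move=> u v uv; apply/rowP => x; apply: (@scale_rep_inj a).
by rewrite -!row_hom_incl uv.
Qed.

(** The coordinates of [q] are its composites with the inclusions: scalars on the copies of [rep a],
    whose endomorphisms are scalar, and zero on all other representatives by Schur's lemma. *)
Lemma row_hom_surj f a (q : hom (rep_sum f) (rep a)) : exists u : 'rV_(f a), row_hom u = q.
Proof.
have /fin_all_exists[w wP] (x : 'I_(f a)) :=
  end_rep_scalar (q \oc incl x).
exists (\row_x w x); rewrite -[RHS]comp1I -incl_proj (comp_sumr Clin).
rewrite [RHS](bigD1 a) //= [X in _ + X]big1 ?addr0 => [|b ba].
  rewrite (comp_sumr Clin); apply: eq_bigr => x _.
  by rewrite mxE compA wP (compZl Clin) compI1.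
rewrite (comp_sumr Clin) big1 // => x _.
by rewrite compA [q \oc _]hom_rep_neq // (comp0l Clin).
Qed.

Lemma row_hom_ext X f (g h : hom X (rep_sum f)) :
  (forall a (u : 'rV_(f a)), row_hom u \oc g = row_hom u \oc h) -> g = h.
Proof.
move=> rgh; apply: rep_jointly_faithful => a q.
by have [u <-] := row_hom_surj q.
Qed.

Definition lift X f (m : forall a, 'I_(f a) -> hom X (rep a)) : hom X (rep_sum f) :=
  \sum_a \sum_(x < f a) (incl x \oc m a x).

Lemma row_hom_lift X f (m : forall a, 'I_(f a) -> hom X (rep a)) a (u : 'rV_(f a)) :
  row_hom u \oc lift m = \sum_x u 0 x *: m a x.
Proof.
rewrite (comp_sumr Clin) (bigD1 a) //= [X in _ + X]big1 ?addr0.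
  rewrite (comp_sumr Clin); apply: eq_bigr => x _.
  by rewrite compA row_hom_incl (compZl Clin) compI1.
move=> b ba; rewrite (comp_sumr Clin) big1 // => x _.
by rewrite compA [row_hom u \oc _]hom_rep_neq // (comp0l Clin).
Qed.

Definition rep_map f g (A : mxfam k f g) : hom (rep_sum f) (rep_sum g) :=
  lift (fun a x => row_hom (row x (A a))).

Lemma row_hom_map f g (A : mxfam k f g) a (u : 'rV_(g a)) :
  row_hom u \oc rep_map A = row_hom (u *m A a).
Proof.
rewrite row_hom_lift mulmx_sum_row linear_sum.
by apply: eq_bigr => x _; rewrite linearZ.
Qed.

Lemma rep_map_linear f g : linear (@rep_map f g).
Proof.
move=> c A B; apply: row_hom_ext => a u.
rewrite row_hom_map mxfam_linE (comp_linr Clin) !row_hom_map.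
by rewrite mulmxDr -scalemxAr linearP.
Qed.

HB.instance Definition _ f g :=
  GRing.isLinear.Build k (mxfam k f g) (hom (rep_sum f) (rep_sum g)) *:%R (@rep_map f g)
    (@rep_map_linear f g).

Lemma rep_map_id f : rep_map (mxfam_id k f) = idm (rep_sum f).
Proof. by apply: row_hom_ext => a u; rewrite row_hom_map mxfam_idE mulmx1 comp1I. Qed.

Lemma rep_map_comp f g h (B : mxfam k g h) (A : mxfam k f g) :
  rep_map (mxfam_comp B A) = rep_map B \oc rep_map A.
Proof.
apply: row_hom_ext => a u.
by rewrite compA !row_hom_map mxfam_compE mulmxA.
Qed.

Definition extracted_functor : linear_functor (system_category S) C :=
  @LinearFunctor k (system_category S) C rep_sum (fun f g => @rep_map f g) rep_map_id rep_map_comp.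

Lemma rep_map_inj f g : injective (@rep_map f g).
Proof.
move=> A B eqAB; apply/ffunP => a; apply/row_matrixP => x.
by apply: row_hom_inj; rewrite !rowE -!row_hom_map eqAB.
Qed.

Lemma rep_map_surj f g (q : hom (rep_sum f) (rep_sum g)) : exists A, rep_map A = q.
Proof.
have /fin_all_exists[A AP] a : exists A : 'M[k]_(g a, f a),
    forall u, row_hom u \oc q = row_hom (u *m A).
  have /fin_all_exists[r rP] x := row_hom_surj (row_hom (delta_mx 0 x : 'rV_(g a)) \oc q).
  exists (\matrix_x r x) => u; rewrite [u in LHS]row_sum_delta.
  rewrite mulmx_sum_row !linear_sum (comp_suml Clin); apply: eq_bigr => x _.
  by rewrite !linearZ (compZl Clin) -rP rowK.
exists [ffun a => A a]; apply: row_hom_ext => a u.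
by rewrite row_hom_map ffunE AP.
Qed.

(** The multiplicity of [rep a] is the dimension of the space of morphisms from [X] to [rep a]. The
    map whose components are bases of these spaces sends a row to the linear combination with these
    coordinates, so it is bijective on homs into each [rep a]. *)
Lemma rep_sum_surj X : exists f, isomorphic (rep_sum f) X.
Proof.
pose f a := \dim {: hom X (rep a)}.
exists f; apply: isomorphic_sym.
pose B a := vbasis {: hom X (rep a)}.
exists (lift (fun a (x : 'I_(f a)) => (B a)`_x)); apply: iso_of_bijective_rep.
  move=> a g h; have [u <-] := row_hom_surj g; have [v <-] := row_hom_surj h.
  rewrite !row_hom_lift => /eqP; rewrite -subr_eq0 -sumrB => /eqP uv.
  congr row_hom; apply/rowP => x; apply/eqP; rewrite -subr_eq0; apply/eqP.
  have /freeP := basis_free (vbasisP {: hom X (rep a)}).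
  move/(_ (fun x => u 0 x - v 0 x)); apply.
  by rewrite -[RHS]uv; apply: eq_bigr => y _; rewrite scalerBl.
move=> a g; exists (row_hom (\row_x coord (B a) x g)); rewrite row_hom_lift.
rewrite [RHS](coord_basis (vbasisP {: hom X (rep a)}) (memvf g)).
by apply: eq_bigr => x _; rewrite mxE.
Qed.

Lemma extracted_equivalence : is_equivalence extracted_functor.
Proof.
apply: fully_faithful_equivalence => //.
- by move=> f g A B; exact: rep_map_inj.
- exact: rep_map_surj.
- exact: rep_sum_surj.
Qed.

(** * Monoidal structure of the functor *)

Variables (rep1 : rep one = unit_obj)
  (eta : forall a b c, 'I_(mult a b c) -> hom (rep a \ot rep b) (rep c)).
Hypothesis eta_basis : forall a b c,
  basis_of fullv [seq @eta a b c i | i : 'I_(mult a b c)].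

Lemma eta_free a b c (w : 'I_(mult a b c) -> k) :
  \sum_l w l *: eta l = 0 -> forall l, w l = 0.
Proof.
move=> w0; pose X := [tuple eta i | i < mult a b c].
have /basis_free etafree := eta_basis a b c.
have /freeP Xfree : free X by exact: etafree.
apply: Xfree; rewrite -[RHS]w0; apply: eq_bigr => l _.
by rewrite -tnth_nth tnth_mktuple.
Qed.

Lemma eta_span a b c (q : hom (rep a \ot rep b) (rep c)) :
  exists w, q = \sum_l w l *: @eta a b c l.
Proof.
pose X := [tuple eta i | i < mult a b c].
have Xbasis : basis_of fullv X by exact: eta_basis.
exists (fun l => coord X l q); rewrite [LHS](coord_basis Xbasis (memvf q)).
by apply: eq_bigr => l _; rewrite -tnth_nth tnth_mktuple.
Qed.


Lemma sum_tens_ix (V : nmodType) f g c (G : 'I_(tens_obj f g c) -> V) :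
  \sum_i G i = \sum_a \sum_b \sum_(x < f a) \sum_(y < g b) \sum_(l < mult a b c)
    G (tens_ix x y l).
Proof.
pose ix (p : tens_index f g c) :=
  tens_ix (tagged p).1.1 (tagged p).1.2 (tagged p).2.
have ixK : cancel ix (@tens_dec k S f g c).
  by case=> -[a' b'] [[x' y'] l']; rewrite /ix tens_ixK.
have decK : cancel (@tens_dec k S f g c) ix.
  by move=> i; case: (tens_ixP i) => a b x y l; rewrite tens_ixK.
rewrite (reindex ix) /=; last by exists (@tens_dec k S f g c) => i _.
rewrite sum_tagged sum_pair; apply: eq_bigr => a _; apply: eq_bigr => b _.
by rewrite !sum_pair.
Qed.

Lemma proj_lift X f (m : forall a, 'I_(f a) -> hom X (rep a)) a (x : 'I_(f a)) :
  proj x \oc lift m = m a x.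
Proof.
rewrite -row_hom_delta row_hom_lift (bigD1 x) //= mxE !eqxx scale1r big1 ?addr0 //.
by move=> y /negPf ne; rewrite mxE ne andbF scale0r.
Qed.

Definition rep_tens f g : hom (rep_sum f \ot rep_sum g) (rep_sum (tens_obj f g)) :=
  lift (fun c i =>
    let: existT (a, b) (x, y, l) := tens_dec i in
    @eta a b c l \oc (proj x \om proj y)).

(** This turns [tens_row] into its meaning in [C], so that naturality and coherence of [rep_tens]
    reduce to the action on rows and the properties of [eta]. *)
Lemma row_hom_tens f g a b c (u : 'rV_(f a)) (v : 'rV_(g b)) (l : 'I_(mult a b c)) :
  row_hom (tens_row u v l) \oc rep_tens f g = eta l \oc (row_hom u \om row_hom v).
Proof.
rewrite /tens_row linear_sum (comp_suml Clin) (tensm_suml Cbil) (comp_sumr Clin).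
apply: eq_bigr => x _; rewrite linear_sum (comp_suml Clin).
rewrite (tensm_sumr Cbil) (comp_sumr Clin); apply: eq_bigr => y _.
rewrite (tensmZl Cbil) (tensmZr Cbil) scalerA.
rewrite linearZ /= (compZl Clin) row_hom_delta proj_lift tens_ixK.
by rewrite (compZr Clin).
Qed.

Lemma tens_row_hom_ext X f g (p q : hom X (rep_sum (tens_obj f g))) :
  (forall a b c (u : 'rV_(f a)) (v : 'rV_(g b)) (l : 'I_(mult a b c)),
     row_hom (tens_row u v l) \oc p = row_hom (tens_row u v l) \oc q) -> p = q.
Proof.
move=> pq; apply: row_hom_ext => c u; rewrite (row_sum_delta u) linear_sum.
rewrite !(comp_suml Clin); apply: eq_bigr => i _.
rewrite linearZ /= !(compZl Clin); congr (_ *: _).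
by case: (tens_ixP i) => a b x y l; rewrite -tens_row_delta pq.
Qed.

Lemma tens_row_hom_extl X f g h (p q : hom X (rep_sum (tens_obj (tens_obj f g) h))) :
  (forall a b c d e (u : 'rV_(f a)) (v : 'rV_(g b)) (w : 'rV_(h c))
     (i : 'I_(mult a b e)) (j : 'I_(mult e c d)),
     row_hom (tens_row (tens_row u v i) w j) \oc p
     = row_hom (tens_row (tens_row u v i) w j) \oc q) -> p = q.
Proof.
move=> pq; apply: row_hom_ext => c u; rewrite (row_sum_delta u) linear_sum.
rewrite !(comp_suml Clin); apply: eq_bigr => i _.
rewrite linearZ /= !(compZl Clin); congr (_ *: _).
case: (tens_ixP i) => e c' t z j; case: (tens_ixP t) => a b x y l.
by rewrite -!tens_row_delta pq.
Qed.

Lemma row_hom_tens_sum f g c (w : 'rV_(tens_obj f g c)) :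
  row_hom w \oc rep_tens f g
  = \sum_a \sum_b \sum_(x < f a) \sum_(y < g b) \sum_(l < mult a b c)
      w 0 (tens_ix x y l) *: (eta l \oc (proj x \om proj y)).
Proof.
rewrite [in LHS](row_sum_delta w) linear_sum (comp_suml Clin) sum_tens_ix.
do 5![apply: eq_bigr => ? _].
rewrite linearZ /= (compZl Clin) -tens_row_delta row_hom_tens.
by rewrite !row_hom_delta.
Qed.

(** A map from the target to [rep c] is a family of coefficients over the blocks of [tens_obj f g].
    Composing with [incl x \om incl y] isolates one block, where independence of the [eta] gives
    injectivity and their spanning gives surjectivity. *)
Lemma rep_tens_iso f g : is_iso (rep_tens f g).
Proof.
apply: iso_of_bijective_rep => c q.
  move=> q'; have [w <-] := row_hom_surj q; have [w' <-] := row_hom_surj q' => ww'.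
  suff : w - w' = 0 by move/eqP; rewrite subr_eq0 => /eqP ->.
  have {ww'} : row_hom (w - w') \oc rep_tens f g = 0.
    by rewrite linearB /= (compBl Clin) ww' subrr.
  move: (w - w') => {q q' w'} {}w; rewrite row_hom_tens_sum => w0.
  apply/rowP => i; rewrite mxE; case: (tens_ixP i) => a b x y l.
  apply: (eta_free (w := fun l => w 0 (tens_ix x y l))).
  have := congr1 (fun q => q \oc (incl x \om incl y)) w0; rewrite (comp0l Clin) => w0'.
  rewrite -[RHS]w0'.
  rewrite (comp_suml Clin) (bigD1 a) //= [X in _ + X]big1 ?addr0; last first.
    move=> a' ne; rewrite (comp_suml Clin) big1 // => b' _.
    rewrite (comp_suml Clin) big1 // => x' _; rewrite (comp_suml Clin) big1 // => y' _.
    rewrite (comp_suml Clin) big1 // => l' _.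
    rewrite (compZl Clin) -compA -(tensm_comp Cmon) [proj x' \oc _]hom_rep_neq 1?eq_sym //.
    by rewrite (tensm0l Cbil) (comp0r Clin) scaler0.
  rewrite (comp_suml Clin) (bigD1 b) //= [X in _ + X]big1 ?addr0; last first.
    move=> b' ne.
    rewrite (comp_suml Clin) big1 // => x' _; rewrite (comp_suml Clin) big1 // => y' _.
    rewrite (comp_suml Clin) big1 // => l' _.
    rewrite (compZl Clin) -compA -(tensm_comp Cmon) [proj y' \oc _]hom_rep_neq 1?eq_sym //.
    by rewrite (tensm0r Cbil) (comp0r Clin) scaler0.
  rewrite (comp_suml Clin) (bigD1 x) //= [X in _ + X]big1 ?addr0; last first.
    move=> x' ne; rewrite (comp_suml Clin) big1 // => y' _.
    rewrite (comp_suml Clin) big1 // => l' _.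
    rewrite (compZl Clin) -compA -(tensm_comp Cmon) proj_incl //.
    by rewrite (tensm0l Cbil) (comp0r Clin) scaler0.
  rewrite (comp_suml Clin) (bigD1 y) //= [X in _ + X]big1 ?addr0; last first.
    move=> y' ne; rewrite (comp_suml Clin) big1 // => l' _.
    rewrite (compZl Clin) -compA -(tensm_comp Cmon) [proj y' \oc _]proj_incl //.
    by rewrite (tensm0r Cbil) (comp0r Clin) scaler0.
  rewrite (comp_suml Clin); apply: eq_bigr => l' _.
  rewrite (compZl Clin) -compA -(tensm_comp Cmon) !projK.
  by rewrite (tensm_id Cmon) comp1I.
have /fin_all_exists[W WP] (a : S) := fin_all_exists (fun b : S =>
  fin_all_exists (fun x : 'I_(f a) => fin_all_exists (fun y : 'I_(g b) =>
    eta_span (q \oc (incl x \om incl y))))).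
exists (row_hom (\row_i let: existT (a, b) (x, y, l) := tens_dec i in W a b x y l)).
rewrite row_hom_tens_sum -[q in RHS]comp1I -(tensm_id Cmon) -!incl_proj.
rewrite (tensm_suml Cbil) (comp_sumr Clin); apply: eq_bigr => a _.
rewrite (tensm_suml Cbil) (comp_sumr Clin) exchange_big /=; apply: eq_bigr => x _.
rewrite (tensm_sumr Cbil) (comp_sumr Clin); apply: eq_bigr => b _.
rewrite (tensm_sumr Cbil) (comp_sumr Clin); apply: eq_bigr => y _.
rewrite (tensm_comp Cmon) compA WP (comp_suml Clin); apply: eq_bigr => l _.
by rewrite mxE tens_ixK (compZl Clin).
Qed.

(** The transport along [rep1] cancels the inverse transport in the normalizations of [eta] by the
    unit isomorphisms. *)
Let rep_unit : hom unit_obj (rep_sum (simple_obj one)) :=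
  incl (simple_ix one) \oc hom_of_eq (esym rep1).

Lemma rep_unit_iso : is_iso rep_unit.
Proof.
apply: is_iso_comp => //.
  by exists (hom_of_eq rep1); apply: inverse_sym; exact: hom_of_eqK.
exists (proj (simple_ix one)); split; first exact: projK.
rewrite -incl_proj (bigD1 one) //= [X in _ + X]big1 ?addr0.
  rewrite (bigD1 (simple_ix one)) //= big1 ?addr0 // => r.
  by rewrite (index1_unique (simple_obj_diag (one : S)) r) eqxx.
move=> a ne; rewrite big1 // => r _.
by rewrite (simple_ix_eq r) eqxx in ne.
Qed.

Lemma row_hom_rep_unit : row_hom (simple_row one) \oc rep_unit = hom_of_eq (esym rep1).
Proof. by rewrite row_hom_delta compA projK compI1. Qed.

Hypothesis eta_lunit : forall a, @eta one a a (idx1l a)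
  = lunit (rep a) \oc (hom_of_eq rep1 \om idm (rep a)).
Hypothesis eta_runit : forall a, @eta a one a (idx1r a)
  = runit (rep a) \oc (idm (rep a) \om hom_of_eq rep1).
Hypothesis eta_assoc : forall a b c u (p : row_index a b c u),
  @eta (tag p) c u (tagged p).2
    \oc (@eta a b (tag p) (tagged p).1 \om idm (rep c))
    \oc assoc (rep a) (rep b) (rep c)
  = \sum_(q : col_index a b c u)
      Fmat p q *: (@eta a (tag q) u (tagged q).1
        \oc (idm (rep a) \om @eta b c (tag q) (tagged q).2)).

Lemma rep_tens_natural f f' g g' (A : mxfam k f f') (B : mxfam k g g') :
  rep_map (tens_mor A B) \oc rep_tens f g = rep_tens f' g' \oc (rep_map A \om rep_map B).
Proof.
apply: tens_row_hom_ext => a b c u v l; rewrite !compA row_hom_tens row_hom_map.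
by rewrite tens_row_mor row_hom_tens -compA -(tensm_comp Cmon) !row_hom_map.
Qed.

(** On left-bracketed rows one side expands by [tens_row_assoc] and the other by [eta_assoc], with
    the same coefficients [F] in front of the same composites. *)
Lemma rep_tens_assoc f g h :
  rep_map (assoc_mor f g h) \oc rep_tens f (tens_obj g h) \oc (idm (rep_sum f) \om rep_tens g h)
  = rep_tens (tens_obj f g) h \oc (rep_tens f g \om idm (rep_sum h))
      \oc assoc (rep_sum f) (rep_sum g) (rep_sum h).
Proof.
apply: tens_row_hom_extl => a b c d e u v w i j; rewrite !compA row_hom_tens row_hom_map.
rewrite tens_row_assoc linear_sum !(comp_suml Clin).
rewrite -[eta j \oc _ \oc _]compA -(tensm_comp Cmon) row_hom_tens comp1I.
rewrite -[row_hom w](compI1) (tensm_comp Cmon) compA -compA -(assoc_natural Cmon) compA.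
rewrite (eta_assoc (row_ix i j)) (comp_suml Clin); apply: eq_bigr => q _.
rewrite linearZ /= !(compZl Clin); congr (_ *: _).
rewrite row_hom_tens -compA -(tensm_comp Cmon) comp1I row_hom_tens.
by rewrite -compA -(tensm_comp Cmon) compI1.
Qed.

Lemma rep_tens_lunit f :
  rep_map (lunit_mor f) \oc rep_tens (simple_obj one) f \oc (rep_unit \om idm (rep_sum f))
  = lunit (rep_sum f).
Proof.
apply: row_hom_ext => a u; rewrite !compA row_hom_map row_lunit row_hom_tens.
rewrite -compA -(tensm_comp Cmon) row_hom_rep_unit comp1I eta_lunit -compA.
rewrite -(tensm_comp Cmon) compI1.
have [_ ->] := hom_of_eqK Ccat rep1.
by rewrite (lunit_natural Cmon).
Qed.

Lemma rep_tens_runit f :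
  rep_map (runit_mor f) \oc rep_tens f (simple_obj one) \oc (idm (rep_sum f) \om rep_unit)
  = runit (rep_sum f).
Proof.
apply: row_hom_ext => a u; rewrite !compA row_hom_map row_runit row_hom_tens.
rewrite -compA -(tensm_comp Cmon) row_hom_rep_unit comp1I eta_runit -compA.
rewrite -(tensm_comp Cmon) compI1.
have [_ ->] := hom_of_eqK Ccat rep1.
by rewrite (runit_natural Cmon).
Qed.

Lemma extracted_fusion_equivalent : fusion_equivalent (system_category S) C.
Proof.
exists extracted_functor; split; last exact: extracted_equivalence.
exists rep_tens, rep_unit; split.
- by split; [exact: rep_tens_iso | exact: rep_unit_iso].
- exact: rep_tens_natural.
- exact: rep_tens_assoc.
- exact: rep_tens_lunit.
- exact: rep_tens_runit.
Qed.

End ExtractedEquivalence.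

Theorem proposition3p7 (k : fieldType) (char0 : [pchar k] =i pred0) :
  (forall S : fusion_system k,
     is_fusion_category (system_category S) /\
     forall f : S -> nat,
       @is_right_dual k (system_category S) f (dual_obj f)
         (coev_mor f) (ev_mor f)) /\
  (forall (C : fusion_category k) (S : fusion_system k),
     extracted C S -> fusion_equivalent (system_category S) C).
Proof.
split=> [S|C S].
  by split; [exact: system_fusion_category | exact: system_right_dual].
case=> rep [rep1 [coev [ev [eta [[simp inj surj] _ basis [etal etar _] etaA]]]]].
apply: (extracted_fusion_equivalent (fusion_ax C) simp inj surj
  (rep1 := rep1) (eta := eta)) => //.
by move=> a b c; have [] := basis a b c.
Qed.
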